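(* Let $\mathcal K$ be one of $\mathcal{LO}_p^H$, $\mathcal{LO}_r^H$, or $\mathcal{PO}_F^H$ with $F$ finite, where $H$ is any (possibly empty) set of conditions each expressible by a 1-universal sentence. Let $\mathcal K^{fin}$ be the class of finite members of $\mathcal K$. If $\mathcal K^{fin}$ is nonempty, then $\mathcal K^{fin}$ has a Fraïssé limit $\mathbf M$ with $\mathbf M\in\mathcal K$. Moreover, if $\mathcal K$ is $\mathcal{LO}_p^H$ or $\mathcal{LO}_r^H$ and $H$ includes the condition $\forall x\, f^{m+2}(x)=f^m(x)$ for some $m\in\mathbb N$ (where $f$ is the unary operation), then the first-order theory $Th(\mathbf M)$ is $\omega$-categorical, has quantifier elimination, and is the model completion of $Th(\mathcal K)$.
   Context: $\mathcal{LO}_p$ (resp. $\mathcal{LO}_r$): linearly ordered sets with one order preserving (resp. order reversing) unary operation $f$. $\mathcal{PO}_F$ ($F=F_1\cup F_2\cup F_3\cup F_4$ a set of unary function symbols): posets where symbols in $F_1,F_2,F_3,F_4$ are interpreted respectively as order preserving, order reversing, strict order preserving, strict order reversing functions. For a set $H$ of conditions, $\mathcal K^H$ is the subclass of those structures satisfying all conditions in $H$. A first-order sentence is 1-universal if it is universal and only one variable occurs in it. $f^0(x)=x$, $f^{n+1}(x)=f(f^n(x))$. A Fraïssé limit of a class $\mathcal F$ of finitely generated structures in a countable language is a countable ultrahomogeneous structure whose age (class of finitely generated structures embeddable in it, up to isomorphism) is exactly $\mathcal F$. $Th(\mathcal K)$ is the set of first-order sentences true in every member of $\mathcal K$. *)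

(* Defs.v *)
From mathcomp Require Import all_boot.
From mathcomp Require Import all_classical.

Set Implicit Arguments.
Unset Strict Implicit.
Unset Printing Implicit Defensive.

Local Open Scope classical_set_scope.

(* The language has equality, one binary relation symbol for the (weak) order
   and a unary function symbol for each element of [F]. As usual in model
   theory, structures are nonempty. *)
Record structure (F : Type) := Structure {
  carrier :> Type;
  sle : carrier -> carrier -> Prop;
  sop : F -> carrier -> carrier;
  carrier_inhabited : inhabited carrier
}.

Section Syntax.
Variable F : Type.

Inductive term : Type :=
| Var of nat
| App of F & term.

Inductive formula : Type :=
| Bot
| Eq of term & term
| Le of term & term
| Imp of formula & formula
| All of nat & formula.

(* All function symbols are unary, so exactly one variable occurs in a term. *)
Fixpoint tvar (t : term) : nat :=
  match t with Var n => n | App _ u => tvar u end.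

Fixpoint free_vars (p : formula) : seq nat :=
  match p with
  | Bot => [::]
  | Eq t u | Le t u => [:: tvar t; tvar u]
  | Imp q r => free_vars q ++ free_vars r
  | All n q => [seq k <- free_vars q | k != n]
  end.

Fixpoint all_vars (p : formula) : seq nat :=
  match p with
  | Bot => [::]
  | Eq t u | Le t u => [:: tvar t; tvar u]
  | Imp q r => all_vars q ++ all_vars r
  | All n q => n :: all_vars q
  end.

Definition sentence (p : formula) : Prop := free_vars p = [::].

Fixpoint quantifier_free (p : formula) : bool :=
  match p with
  | Bot | Eq _ _ | Le _ _ => true
  | Imp q r => quantifier_free q && quantifier_free r
  | All _ _ => false
  end.

Fixpoint universal (p : formula) : bool :=
  if p is All _ q then universal q else quantifier_free p.

Definition one_universal (p : formula) : Prop :=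
  [/\ sentence p, universal p & exists n, all (pred1 n) (all_vars p)].

Fixpoint eval (A : structure F) (v : nat -> A) (t : term) : A :=
  match t with Var n => v n | App g u => sop g (eval v u) end.

Definition update (A : Type) (v : nat -> A) (n : nat) (a : A) : nat -> A :=
  fun k => if k == n then a else v k.

Fixpoint sat (A : structure F) (v : nat -> A) (p : formula) : Prop :=
  match p with
  | Bot => False
  | Eq t u => eval v t = eval v u
  | Le t u => sle (eval v t) (eval v u)
  | Imp q r => sat v q -> sat v r
  | All n q => forall a : A, sat (update v n a) q
  end.

Definition holds (A : structure F) (p : formula) : Prop :=
  forall v : nat -> A, sat v p.

End Syntax.

Arguments Bot {F}.
Arguments Var {F}.

Section ModelTheory.
Variable F : Type.
Implicit Types (A B C M : structure F) (T : set (formula F)).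

Definition embedding A B (h : A -> B) : Prop :=
  [/\ injective h,
      forall x y, sle (h x) (h y) <-> sle x y
    & forall g x, h (sop g x) = sop g (h x)].

Definition isomorphism A B (h : A -> B) : Prop :=
  embedding h /\ forall y, exists x, h x = y.

Definition op_closed A (S : set A) : Prop := forall g x, S x -> S (sop g x).

Definition generated A (X : set A) : set A :=
  [set x | forall S : set A, op_closed S -> X `<=` S -> S x].

Definition finitely_generated A : Prop :=
  exists X : set A, finite_set X /\ generated X = [set: A].

Record subuniverse A := Subuniverse {
  subset_of : set A;
  subset_of_closed : op_closed subset_of;
  subset_of_nonempty : exists x, subset_of x
}.

Definition substructure A (S : subuniverse A) : structure F :=
  @Structure F {x : A | subset_of S x}
    (fun x y => sle (sval x) (sval y))
    (fun g x => exist _ (sop g (sval x)) (subset_of_closed g (svalP x)))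
    (let: ex_intro x Sx := subset_of_nonempty S in inhabits (exist _ x Sx)).

Definition ultrahomogeneous M : Prop :=
  forall S S' : subuniverse M,
    finitely_generated (substructure S) ->
    finitely_generated (substructure S') ->
    forall h : substructure S -> substructure S', isomorphism h ->
    exists s : M -> M,
      isomorphism s /\ forall x : substructure S, s (sval x) = sval (h x).

Definition age M : set (structure F) :=
  [set A | finitely_generated A /\ exists h : A -> M, embedding h].

Definition fraisse_limit (K : set (structure F)) M : Prop :=
  [/\ countable [set: M], ultrahomogeneous M & forall A, age M A <-> K A].

Definition theory_of (K : set (structure F)) : set (formula F) :=
  [set p | sentence p /\ forall A, K A -> holds A p].

Definition Th M : set (formula F) := theory_of [set M].

Definition models T A : Prop := forall p, T p -> holds A p.

(* "Countable" means finite or denumerable, so that the complete theory of a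
   finite structure is also omega-categorical. *)
Definition omega_categorical T : Prop :=
  (exists A, models T A /\ countable [set: A]) /\
  (forall A B, models T A -> models T B ->
     countable [set: A] -> countable [set: B] ->
     exists h : A -> B, isomorphism h).

Definition quantifier_elimination T : Prop :=
  forall p : formula F, exists q : formula F,
    [/\ quantifier_free q,
        {subset free_vars q <= free_vars p}
      & forall A, models T A -> forall v : nat -> A, sat v p <-> sat v q].

(* The models of [T' + Diag A] are the models of [T'] together with an
   embedding of [A]; [diagram_complete T' A] says that any two of them satisfy
   the same sentences with parameters from [A]. *)
Definition diagram_complete (T' : set (formula F)) A : Prop :=
  forall B C (h : A -> B) (k : A -> C),
    models T' B -> models T' C -> embedding h -> embedding k ->
    forall (p : formula F) (v : nat -> A), sat (h \o v) p <-> sat (k \o v) p.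

Definition model_completion (T' T : set (formula F)) : Prop :=
  [/\ forall A, models T' A -> models T A,
      forall A, models T A ->
        exists B, models T' B /\ exists h : A -> B, embedding h
    & forall A, models T A -> diagram_complete T' A].

End ModelTheory.

Section Orders.
Variables (F : Type) (A : structure F).

Definition slt (x y : A) : Prop := sle x y /\ x <> y.

Definition partial_order : Prop :=
  [/\ forall x : A, sle x x,
      forall x y : A, sle x y -> sle y x -> x = y
    & forall x y z : A, sle x y -> sle y z -> sle x z].

Definition linear_order : Prop :=
  partial_order /\ forall x y : A, sle x y \/ sle y x.

Definition order_preserving (g : F) : Prop :=
  forall x y : A, sle x y -> sle (sop g x) (sop g y).

Definition order_reversing (g : F) : Prop :=
  forall x y : A, sle x y -> sle (sop g y) (sop g x).

Definition strict_order_preserving (g : F) : Prop :=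
  forall x y : A, slt x y -> slt (sop g x) (sop g y).

Definition strict_order_reversing (g : F) : Prop :=
  forall x y : A, slt x y -> slt (sop g y) (sop g x).

End Orders.

Definition LO_p : set (structure unit) :=
  [set A | linear_order A /\ order_preserving A tt].

Definition LO_r : set (structure unit) :=
  [set A | linear_order A /\ order_reversing A tt].

Definition PO (F : finType) (F1 F2 F3 F4 : {set F}) : set (structure F) :=
  [set A | partial_order A /\
     [/\ forall g, g \in F1 -> order_preserving A g,
         forall g, g \in F2 -> order_reversing A g,
         forall g, g \in F3 -> strict_order_preserving A g
       & forall g, g \in F4 -> strict_order_reversing A g]].

(* A condition on structures is identified with the class of structures that
   satisfy it. *)
Definition expressible_one_universal (F : Type) (c : set (structure F)) : Prop :=
  exists p : formula F, one_universal p /\ forall A, c A <-> holds A p.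

Definition satisfying (F : Type) (K : set (structure F))
    (H : set (set (structure F))) : set (structure F) :=
  [set A | K A /\ forall c, H c -> c A].

Definition finite_members (F : Type) (K : set (structure F)) :
    set (structure F) :=
  [set A | K A /\ finite_set [set: A]].

(* The condition "f^(m+2) (x) = f^m (x) for all x". *)
Definition iterate_condition (m : nat) : set (structure unit) :=
  [set A : structure unit | forall x : A, iter m.+2 (sop tt) x = iter m (sop tt) x].

(* Main.v *)
(* Amalgams are built as quotients of preorders on the disjoint sum [A + B].
   Amalgamating over a partial isomorphism given by its graph, which may be
   empty, yields joint embedding as well. For posets the free amalgam works:
   [a <= b] iff [a <= c <= b] for some [c] in the common part. For chains one
   linearises the free amalgam one incomparable pair [a, b] at a time: all orbits
   are eventually periodic, so one may assume that [f a, f b] are already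
   comparable, or that [a, b] are periodic, and then one of the two orders
   between [a] and [b] is compatible with [f]. A 1-universal sentence passes to
   the amalgam because every element comes from [A] or from [B].

   If [f^(m+2) = f^m], finitely many atomic formulas determine the isomorphism
   type of the substructure generated by a tuple, hence by homogeneity the truth
   in [M] of any formula at that tuple; this gives quantifier elimination.
   Back-and-forth through the eliminated formulas gives omega-categoricity, and
   a chain in [K] embeds into an ultrapower of [M] because its finitely generated
   substructures embed into [M]. *)

Require Import Defs.
From Stdlib Require List.
From mathcomp Require Import all_boot.
From mathcomp Require Import all_classical.

Set Implicit Arguments.
Unset Strict Implicit.
Unset Printing Implicit Defensive.

Local Open Scope classical_set_scope.

(** * Satisfaction and embeddings *)

(** For a reversing map the obstacle is the fixed point. A chain has at most one, so the fixed
    points of two factors must be glued even where the given partial isomorphism does not mention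
    them; and among points of period two, deciding [a <= b] also decides [f b <= f a]. The gap 2 in
    [f^(m+2) = f^m] is the largest period that an orbit can have in a finite chain of either kind.
    Only finite members are amalgamated, since an infinite orbit need not become periodic and the
    induction on the distance to the periodic part would have no start. That the limit lies in the
    class is a separate matter: it is a union of finite members, and each axiom looks at no more
    than three elements and their images. The limit is built from structures on initial segments of
    the naturals whose inclusions keep all numbers. An extension problem is then a finite list of
    pairs of numbers that stays meaningful at all later stages, and each problem comes up infinitely
    often. *)

Lemma InP (T : eqType) (x : T) (s : seq T) : reflect (List.In x s) (x \in s).
Proof.
apply: (iffP idP); elim: s => //= y s IHs.
- by rewrite in_cons => /orP[/eqP->|/IHs]; [left|right].
- by move=> [->|/IHs]; rewrite in_cons ?eqxx // => ->; rewrite orbT.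
Qed.

Lemma finite_setE_In (T : Type) (X : set T) :
  finite_set X <-> exists s : seq T, forall x, X x -> List.In x s.
Proof.
split=> [/(@finite_seqP {classic T})[s Xs]|[s Xs]].
  by exists s => x; rewrite Xs => /(InP (T := {classic T})).
apply: (@sub_finite_set {classic T} _ [set` (s : seq {classic T})]); last exact: finite_seq.
by move=> x /Xs /(InP (T := {classic T})).
Qed.

Section Syntax.
Variable F : Type.
Implicit Types (A B M : structure F) (p q : formula F) (t : term F).

Lemma update_id (T : Type) (v : nat -> T) n : update v n (v n) = v.
Proof. by apply/funext => k; rewrite /update; case: eqP => // ->. Qed.

Lemma update_comp (S T : Type) (h : S -> T) (v : nat -> S) n a :
  update (h \o v) n (h a) = h \o update v n a.
Proof. by apply/funext => k; rewrite /update /=; case: eqP. Qed.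

Lemma eval_tvar A (v w : nat -> A) t :
  v (tvar t) = w (tvar t) -> eval v t = eval w t.
Proof. by elim: t => //= g t IHt /IHt ->. Qed.

Lemma eval_embedding A B (h : A -> B) (v : nat -> A) t :
  embedding h -> eval (h \o v) t = h (eval v t).
Proof. by case=> _ _ h_op; elim: t => //= g t ->; rewrite h_op. Qed.

Lemma sat_free_vars A p (v w : nat -> A) :
  {in free_vars p, v =1 w} -> sat v p <-> sat w p.
Proof.
elim: p v w => [|t u|t u|p IHp q IHq|n p IHp] v w vw //=.
- by rewrite !(@eval_tvar _ v w) //; apply: vw; rewrite !inE eqxx ?orbT.
- by rewrite !(@eval_tvar _ v w) //; apply: vw; rewrite !inE eqxx ?orbT.
- have [] : (sat v p <-> sat w p) /\ (sat v q <-> sat w q); last by tauto.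
  by split; [apply: IHp|apply: IHq] => k pk; apply: vw; rewrite mem_cat pk ?orbT.
- suff E a : sat (update v n a) p <-> sat (update w n a) p.
    by split=> H a; apply/E.
  apply: IHp => k pk; rewrite /update; case: eqP => // /eqP kn.
  by apply: vw; rewrite mem_filter kn.
Qed.

Lemma sat_isomorphism A B (h : A -> B) p (v : nat -> A) :
  isomorphism h -> sat v p <-> sat (h \o v) p.
Proof.
move=> [eh h_surj]; have [h_inj h_le _] := eh.
elim: p v => [|t u|t u|p IHp q IHq|n p IHp] v //=.
- by rewrite !eval_embedding //; split=> [->|/h_inj].
- by rewrite !eval_embedding // h_le.
- by rewrite IHp IHq.
- split=> H a; last by apply/IHp; rewrite -update_comp; apply: H.
  by have [x <-] := h_surj a; rewrite update_comp; apply/IHp/H.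
Qed.

Lemma sat_embedding A B (h : A -> B) p (v : nat -> A) :
  embedding h -> quantifier_free p -> sat v p <-> sat (h \o v) p.
Proof.
move=> eh; have [h_inj h_le _] := eh.
elim: p v => [|t u|t u|p IHp q IHq|n p IHp] v //=.
- by rewrite !eval_embedding //; split=> [->|/h_inj].
- by rewrite !eval_embedding // h_le.
- by move=> /andP[/IHp-> /IHq->].
Qed.

Lemma sat_universal A B (h : A -> B) p (v : nat -> A) :
  embedding h -> universal p -> sat (h \o v) p -> sat v p.
Proof.
move=> eh; elim: p v => [|t u|t u|p IHp q IHq|n p IHp] v //.
- by move=> qf /(sat_embedding v eh qf).
- by move=> qf /(sat_embedding v eh qf).
- by move=> qf /(sat_embedding v eh qf).
- by move=> /= up H a; apply: IHp => //; rewrite -update_comp.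
Qed.

Lemma holds_universal A B (h : A -> B) p :
  embedding h -> universal p -> holds B p -> holds A p.
Proof. by move=> eh up Bp v; apply: (sat_universal eh up). Qed.

Lemma holds_all A n p : holds A (All n p) <-> holds A p.
Proof.
split=> Ap v; last by move=> a; apply: Ap.
by have := Ap v (v n); rewrite update_id.
Qed.

Lemma qf_free_vars p : quantifier_free p -> free_vars p = all_vars p.
Proof. by elim: p => //= p IHp q IHq /andP[/IHp-> /IHq->]. Qed.

(** Leading quantifiers do not affect validity under all valuations, and the matrix then speaks
    about a single element of [B], which lies in a copy of a structure where [p] holds. *)
Lemma holds_one_universal B p : one_universal p ->
  (forall b : B, exists A (h : A -> B), [/\ embedding h, holds A p & exists a, h a = b]) ->
  holds B p.
Proof.
move=> [_ up [n pn]] loc.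
have qf_case q : quantifier_free q -> all (pred1 n) (all_vars q) ->
    (forall A, holds A p -> holds A q) -> holds B q.
  move=> qf qn pq v; have [A [h [eh /pq Aq [a ha]]]] := loc (v n).
  have vE : {in free_vars q, v =1 h \o fun=> a}.
    by move=> k; rewrite qf_free_vars // => /(allP qn)/eqP->; rewrite /= ha.
  exact/(sat_free_vars vE)/(sat_embedding _ eh qf)/Aq.
(* Generalising only some occurrences of [p] in this triviality gives the invariant: the subformula
   reached by stripping quantifiers holds wherever the original [p] does. *)
have : forall A, holds A p -> holds A p by [].
elim: {1 2 4 5}p up pn => [|t u|t u|q IHq r IHr|k q IHq] up pn pq; try exact: qf_case.
move: pn => /= /andP[_ pn]; apply/holds_all/IHq => // A /pq.
by move/holds_all.
Qed.

(** Theories consist of sentences; the closure lets open formulas serve as axioms. *)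
Definition closure p := foldr (@All F) p (free_vars p).

Lemma closure_sentence p : sentence (closure p).
Proof.
rewrite /sentence /closure.
have -> s : free_vars (foldr (@All F) p s) = [seq k <- free_vars p | k \notin s].
  elim: s => /= [|n s ->]; first by rewrite filter_predT.
  by rewrite -filter_predI; apply: eq_filter => k; rewrite !inE /= negb_or.
by apply/eqP; rewrite -(negbK (_ == _)) -has_filter; apply/hasPn => k ->.
Qed.

Lemma holds_closure A p : holds A (closure p) <-> holds A p.
Proof. by rewrite /closure; elim: (free_vars p) => //= n s IHs; rewrite holds_all. Qed.

Lemma theory_of_holds (K : set (structure F)) A p :
  models (theory_of K) A -> (forall B, K B -> holds B p) -> holds A p.
Proof.
move=> TA Kp; apply/holds_closure/TA.
by split=> [|B KB]; [apply: closure_sentence|apply/holds_closure/Kp].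
Qed.

Lemma Th_holds M A p : models (Th M) A -> holds M p -> holds A p.
Proof. by move=> TA Mp; apply: (theory_of_holds TA) => _ ->. Qed.

End Syntax.

(** * Extending preorders *)

Section Preorders.
Variable X : Type.
Implicit Types (L : X -> X -> Prop) (a b x y z : X).

Definition preorder L : Prop :=
  (forall x, L x x) /\ (forall x y z, L x y -> L y z -> L x z).

(** One quotient for three uses: the disjoint sum of two structures, the disjoint union of a chain
    of structures, and the functions that represent elements of an ultrapower. *)
Lemma preorder_quotient (F : Type) L (op : F -> X -> X) :
  inhabited X -> preorder L ->
  (forall g x y, L x y -> L y x -> L (op g x) (op g y)) ->
  exists (D : structure F) (pi : X -> D),
    [/\ forall d, exists x, pi x = d,
        forall x y, sle (pi x) (pi y) <-> L x y,
        forall g x, pi (op g x) = sop g (pi x)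
      & partial_order D].
Proof.
move=> [x0] [Lrefl Ltrans] Lop.
pose cls x y := L x y /\ L y x.
pose D := {S : X -> Prop | exists x, S = cls x}.
pose pi x : D := exist _ (cls x) (ex_intro _ x erefl).
have repP (d : D) : exists x, pi x = d.
  by case: d => S [x Sx]; exists x; apply: eq_exist.
pose rep d := projT1 (cid (repP d)).
have repK d : pi (rep d) = d by rewrite /rep; case: cid.
have eq_pi x y : L x y -> L y x -> pi x = pi y.
  move=> xy yx; apply: eq_exist; apply/funext => z; apply/propext.
  by split=> -[Lz zL]; split; apply: (Ltrans); eassumption.
have pi_eq x y : pi x = pi y -> L x y.
  by move=> /(congr1 sval) /= E; have : cls x x by []; rewrite E => -[].
have [Lr rL] : (forall x, L x (rep (pi x))) /\ (forall x, L (rep (pi x)) x).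
  by split=> x; apply: pi_eq; rewrite repK.
pose DS := @Structure F D (fun d e => L (rep d) (rep e))
             (fun g d => pi (op g (rep d))) (inhabits (pi x0)).
exists DS, pi; split=> //= [x y|g x|].
- by split=> xy; [apply: (Ltrans) (rL y); apply: (Ltrans) xy
                 |apply: (Ltrans) (Lr y); apply: (Ltrans) xy].
- by apply: eq_pi; apply: Lop.
- split=> /= [d|d e de ed|d e f]; [exact: Lrefl| |exact: Ltrans].
  by rewrite -(repK d) -(repK e); apply: eq_pi.
Qed.

Definition add_le L a b x y : Prop := L x y \/ L x a /\ L b y.

Lemma add_le_preorder L a b : preorder L -> preorder (add_le L a b).
Proof.
move=> [Lrefl Ltrans]; split=> [x|x y z]; first by left.
move=> [xy|[xa by_]] [yz|[ya bz]].
- by left; apply: (Ltrans) yz.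
- by right; split=> //; apply: (Ltrans) ya.
- by right; split=> //; apply: (Ltrans) yz.
- by right.
Qed.

(* Strict inequalities stay strict, so on a chain the two relations agree. *)
Definition refines L L' : Prop :=
  (forall x y, L x y -> L' x y) /\ (forall x y, L x y -> L' y x -> L y x).

Lemma refines_trans L L' L'' : refines L L' -> refines L' L'' -> refines L L''.
Proof.
move=> [LL' L'L] [L'L'' L''L']; split=> [x y /LL'/L'L''//|x y xy yx].
by apply: L'L => //; apply: L''L' => //; apply: LL'.
Qed.

Lemma refines_add_le L a b : preorder L -> ~ L b a -> refines L (add_le L a b).
Proof.
move=> [_ Ltrans] ba; split=> [x y xy|x y xy [//|[ya bx]]]; first by left.
by case: ba; apply: (Ltrans) bx _; apply: (Ltrans) ya.
Qed.

(** The finitely many pairs are treated one after another; a comparison once made survives, since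
    refinement only adds to the relation. *)
Lemma refines_total (Good : (X -> X -> Prop) -> Prop) :
  finite_set [set: X] ->
  (forall L, Good L -> forall a b,
     exists L', [/\ Good L', refines L L' & L' a b \/ L' b a]) ->
  forall L, Good L ->
    exists L', [/\ Good L', refines L L' & forall a b, L' a b \/ L' b a].
Proof.
move=> /finite_setE_In[s sX] ext L GL.
pose s2 := List.list_prod s s.
suff [L' [GL' LL' H]] : exists L', [/\ Good L', refines L L' &
    forall a b, List.In (a, b) s2 -> L' a b \/ L' b a].
  by exists L'; split=> // a b; apply/H/List.in_prod; apply: sX.
elim: s2 => [|[a b] s2 [L' [GL' LL' IH]]] /=; first by exists L.
have [L'' [GL'' LL'' ab]] := ext _ GL' a b.
exists L''; split=> // [|x y]; first exact: refines_trans LL''.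
by move=> [[<- <-]//|/IH[]/(LL''.1 _ _)]; [left|right].
Qed.

(** * Adding a comparison compatible with a monotone or antitone map *)

Section Operation.
Variable f : X -> X.

Definition preserving_preorder L : Prop :=
  preorder L /\ forall x y, L x y -> L (f x) (f y).

(** Induction on the number of steps after which both orbits are constant. Once [f a <= f b] is
    known, adding [a <= b] is compatible with [f]: from [x <= a] and [b <= y] follows
    [f x <= f a <= f b <= f y]. At the start both points are fixed, and the added pair is mapped to
    itself. *)
Lemma preserving_comparable a b :
  (exists n, f (iter n f a) = iter n f a) ->
  (exists n, f (iter n f b) = iter n f b) ->
  forall L, preserving_preorder L ->
    exists L', [/\ preserving_preorder L', refines L L' & L' a b \/ L' b a].
Proof.
move=> [n an] [m bm].
have iter_fix x i j : f (iter i f x) = iter i f x -> f (iter (i + j) f x) = iter (i + j) f x.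
  move=> fx; suff -> : iter (i + j) f x = iter i f x by [].
  by elim: j => [|j IHj]; rewrite ?addn0 // addnS /= IHj.
move: (iter_fix a n m an) (iter_fix b m n bm); rewrite [(m + n)%N]addnC.
have add a' b' L : preserving_preorder L -> L (f a') (f b') \/ f a' = a' /\ f b' = b' ->
    ~ L b' a' -> exists L', [/\ preserving_preorder L', refines L L' & L' a' b'].
  move=> [Lpre Lf] fab ba; exists (add_le L a' b'); split; last 2 first.
  - exact: refines_add_le.
  - by right; split; apply: Lpre.1.
  split=> [|x y [xy|[/Lf xa /Lf by_]]]; first exact: add_le_preorder.
    by left; apply: Lf.
  case: fab => [fab|[fa fb]]; last by right; rewrite fa in xa; rewrite fb in by_.
  by left; apply: Lpre.2 xa _; apply: Lpre.2 by_.
elim: (n + m)%N a b {an bm} => {n m} [|n IHn] a b fa fb L GL.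
  have [ba|/(add _ _ _ GL)[]] := pselect (L b a); first by exists L; split=> //; right.
    by right.
  by move=> L' [? ? ?]; exists L'; split=> //; left.
rewrite !iterSr in fa fb.
have [L' [GL' LL' fab]] := IHn _ _ fa fb L GL.
have [ba|ba] := pselect (L' b a); first by exists L'; split=> //; right.
have [ab|ab] := pselect (L' a b); first by exists L'; split=> //; left.
case: fab => fab.
- have [|L'' [? LL'' ?]] := add _ _ _ GL' _ ba; first by left.
  by exists L''; split=> //; [apply: refines_trans LL''|left].
- have [|L'' [? LL'' ?]] := add _ _ _ GL' _ ab; first by left.
  by exists L''; split=> //; [apply: refines_trans LL''|right].
Qed.

(** The third clause prevents refinements from creating fixed points. The fourth is forced in the
    final chain: if [x] and [y] are fixed up to equivalence, [x <= y] implies [y <= x]. *)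
Definition reversing_preorder L : Prop :=
  [/\ preorder L, forall x y, L x y -> L (f y) (f x),
      forall x, L x (f x) \/ L (f x) x
    & forall x y, L x (f x) -> L (f x) x -> L y (f y) -> L (f y) y -> L x y].

(** [L] already compares each point with its image and strict comparisons stay strict, so both
    relations have the same fixed points up to equivalence. *)
Lemma refines_reversing L L' : reversing_preorder L -> refines L L' -> preorder L' ->
  (forall x y, L' x y -> L' (f y) (f x)) -> reversing_preorder L'.
Proof.
move=> [_ _ Lcmp Lfix] [LL' L'L] L'pre L'f; split=> // [x|x y].
  by case: (Lcmp x) => /LL'; [left|right].
have eqv z : L' z (f z) -> L' (f z) z -> L z (f z) /\ L (f z) z.
  by move=> zf fz; case: (Lcmp z) => zL; split=> //; apply: L'L.
by move=> x1 x2 y1 y2; apply: LL'; apply: Lfix; case: (eqv _ x1 x2); case: (eqv _ y1 y2).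
Qed.

(** From [x <= a] and [b <= y] follows [f y <= f b <= f a <= f x], which [L] already contains. *)
Lemma reversing_comparable_step L a b : reversing_preorder L -> L (f b) (f a) ->
  ~ L b a -> exists L', [/\ reversing_preorder L', refines L L' & L' a b].
Proof.
move=> GL fba ba; have [Lpre Lf _ _] := GL.
exists (add_le L a b); split; last 2 first.
- exact: refines_add_le.
- by right; split; apply: Lpre.1.
apply: (refines_reversing GL); [exact: refines_add_le|exact: add_le_preorder|].
move=> x y [/Lf|[/Lf xa /Lf by_]]; left=> //.
by apply: Lpre.2 by_ _; apply: Lpre.2 xa.
Qed.

(** Adding [a <= b] forces [f b <= f a], and [L'] is the closure under both pairs. Following the
    first pair by the second yields nothing new because [a <= f a]; following the second by the
    first would need [f a <= a]. *)
Lemma reversing_comparable_lower L a b : reversing_preorder L ->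
  f (f a) = a -> f (f b) = b -> L a (f a) -> ~ L (f a) a -> L b (f b) -> ~ L b a ->
  exists L', [/\ reversing_preorder L', refines L L' & L' a b].
Proof.
move=> GL ffa ffb afa faa bfb ba; have [Lpre Lf _ _] := GL.
have [Lrefl Ltrans] := Lpre.
pose L' x y := [\/ L x y, L x a /\ L b y | L x (f b) /\ L (f a) y].
have LL' : refines L L'.
  split=> [x y xy|x y xy [//|[ya bx]|[yb ax]]]; first by constructor 1.
  - by case: ba; apply: (Ltrans) bx _; apply: (Ltrans) ya.
  - case: ba; rewrite -ffa -ffb; apply: Lf.
    by apply: (Ltrans) ax _; apply: (Ltrans) yb.
exists L'; split=> //; last by constructor 2.
apply: (refines_reversing GL) => //.
  split=> [x|x y z]; first by constructor 1.
  move=> [xy|[xa by_]|[xb ay]] [yz|[ya bz]|[yb az]].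
  - by constructor 1; apply: (Ltrans) yz.
  - by constructor 2; split=> //; apply: (Ltrans) ya.
  - by constructor 3; split=> //; apply: (Ltrans) yb.
  - by constructor 2; split=> //; apply: (Ltrans) yz.
  - by constructor 2.
  - by constructor 1; apply: (Ltrans) xa _; apply: (Ltrans) az.
  - by constructor 3; split=> //; apply: (Ltrans) yz.
  - by case: faa; apply: (Ltrans) ya.
  - by constructor 3.
move=> x y [/Lf|[/Lf xa /Lf by_]|[/Lf xb /Lf ay]]; first by constructor 1.
- by constructor 3.
- by constructor 2; rewrite ffa in ay; rewrite ffb in xb.
Qed.

(** A point above its image is replaced by that image, which lies below its own; the comparison
    found is carried back with [f]. *)
Lemma reversing_comparable_periodic L a b : reversing_preorder L ->
  f (f a) = a -> f (f b) = b ->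
  exists L', [/\ reversing_preorder L', refines L L' & L' a b \/ L' b a].
Proof.
have low a' b' : reversing_preorder L -> f (f a') = a' -> f (f b') = b' ->
    L a' (f a') -> L b' (f b') ->
    exists L', [/\ reversing_preorder L', refines L L' & L' a' b' \/ L' b' a'].
  move=> GL ffa ffb afa bfb.
  have [ba|ba] := pselect (L b' a'); first by exists L; split=> //; right.
  have [ab|ab] := pselect (L a' b'); first by exists L; split=> //; left.
  (* The preceding lemma wants its first point strictly below its image. If [a'] is fixed up to
     equivalence, the roles are exchanged; if both points are, the fourth clause compares them. *)
  have [faa|faa] := pselect (L (f a') a'); last first.
    have [L' [? ? ?]] := reversing_comparable_lower GL ffa ffb afa faa bfb ba.
    by exists L'; split=> //; left.
  have [fbb|fbb] := pselect (L (f b') b'); first by case: ab; have [_ _ _] := GL; apply.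
  have [L' [? ? ?]] := reversing_comparable_lower GL ffb ffa bfb fbb afa ab.
  by exists L'; split=> //; right.
move=> GL ffa ffb; have [_ _ Lcmp _] := GL.
have [[afa|faa] [bfb|fbb]] := (Lcmp a, Lcmp b).
- exact: low.
- have [|||L' [GL' LL' ab]] := low a (f b) GL ffa; rewrite ?ffb //.
  have [[_ Ltr] Lf _ _] := GL'; exists L'; split=> //; left.
  case: ab => [ab|/Lf]; first by apply: (Ltr) ab _; apply: LL'.1.
  by rewrite ffb; apply: (Ltr); apply: LL'.1.
- have [|||L' [GL' LL' ab]] := low (f a) b GL _ ffb; rewrite ?ffa //.
  have [[_ Ltr] Lf _ _] := GL'; exists L'; split=> //; right.
  case: ab => [/Lf|ab]; last by apply: (Ltr) ab _; apply: LL'.1.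
  by rewrite ffa; apply: (Ltr); apply: LL'.1.
- have [||||L' [GL' LL' ab]] := low (f a) (f b) GL; rewrite ?ffa ?ffb //.
  have [_ Lf _ _] := GL'; exists L'; split=> //.
  by case: ab => /Lf; rewrite ffa ffb; [right|left].
Qed.

Lemma reversing_comparable a b :
  (exists n, f (f (iter n f a)) = iter n f a) ->
  (exists n, f (f (iter n f b)) = iter n f b) ->
  forall L, reversing_preorder L ->
    exists L', [/\ reversing_preorder L', refines L L' & L' a b \/ L' b a].
Proof.
move=> [n an] [m bm].
have iter_fix x i j : f (f (iter i f x)) = iter i f x ->
    f (f (iter (i + j) f x)) = iter (i + j) f x.
  by move=> fx; elim: j => [|j IHj]; rewrite ?addn0 // addnS /= IHj.
move: (iter_fix a n m an) (iter_fix b m n bm); rewrite [(m + n)%N]addnC.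
elim: (n + m)%N a b {an bm} => {n m} [|n IHn] a b fa fb L GL.
  exact: reversing_comparable_periodic.
rewrite !iterSr in fa fb.
have [L' [GL' LL' fab]] := IHn _ _ fa fb L GL.
have [ba|ba] := pselect (L' b a); first by exists L'; split=> //; right.
have [ab|ab] := pselect (L' a b); first by exists L'; split=> //; left.
case: fab => fab.
- have [L'' [? LL'' ?]] := reversing_comparable_step GL' fab ab.
  by exists L''; split=> //; [apply: refines_trans LL''|right].
- have [L'' [? LL'' ?]] := reversing_comparable_step GL' fab ba.
  by exists L''; split=> //; [apply: refines_trans LL''|left].
Qed.

End Operation.
End Preorders.

(** * Amalgams of posets *)

Section PartialIsomorphisms.
Variable F : Type.
Implicit Types A B D : structure F.

(* An isomorphism between possibly empty subuniverses of posets [A] and [B],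
   given by its graph; it is single-valued and injective by antisymmetry. *)
Definition piso A B (R : A -> B -> Prop) : Prop :=
  (forall a a' b b', R a b -> R a' b' -> (sle a a' <-> sle b b')) /\
  (forall g a b, R a b -> R (sop g a) (sop g b)).

Lemma piso_inv A B (R : A -> B -> Prop) : piso R -> piso (fun b a => R a b).
Proof.
by move=> [Rle Rop]; split=> [b b' a a' ab ab'|g b a]; [rewrite (Rle _ _ _ _ ab ab')|apply: Rop].
Qed.

Lemma piso_fun A B (R : A -> B -> Prop) a b b' : partial_order B -> piso R ->
  R a b -> R a b' -> b = b'.
Proof.
move=> [Brefl Banti _] [Rle _] ab ab'.
have aa : sle a a by apply/(Rle _ _ _ _ ab ab)/Brefl.
by apply: Banti; [apply/(Rle _ _ _ _ ab ab')|apply/(Rle _ _ _ _ ab' ab)].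
Qed.

Lemma embedding_poset A B (h : A -> B) : partial_order A ->
  (forall x y, sle (h x) (h y) <-> sle x y) ->
  (forall g x, h (sop g x) = sop g (h x)) -> embedding h.
Proof.
move=> [Arefl Aanti _] hle hop; split=> // x y hxy.
by apply: Aanti; apply/hle; rewrite hxy; apply/hle/Arefl.
Qed.

Definition amalgamation (K : set (structure F)) : Prop :=
  forall A B (R : A -> B -> Prop), finite_members K A -> finite_members K B ->
    piso R ->
    exists D (u : A -> D) (v : B -> D),
      [/\ finite_members K D, embedding u, embedding v
        & forall a b, R a b -> u a = v b].

Section Amalgam.
Variables (A B : structure F) (R : A -> B -> Prop).
Hypotheses (Apo : partial_order A) (Bpo : partial_order B) (Riso : piso R).

Definition sum_op (g : F) (x : A + B) : A + B :=
  match x with inl a => inl (sop g a) | inr b => inr (sop g b) end.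

Definition free_le (x y : A + B) : Prop :=
  match x, y with
  | inl a, inl a' => sle a a'
  | inr b, inr b' => sle b b'
  | inl a, inr b => exists c d, [/\ R c d, sle a c & sle d b]
  | inr b, inl a => exists c d, [/\ R c d, sle b d & sle c a]
  end.

Lemma free_le_preorder : preorder free_le.
Proof.
have [[Arefl _ Atr] [Brefl _ Btr]] := (Apo, Bpo); have [Rle _] := Riso.
split=> [[a|b]|[x|x] [y|y] [z|z]] //=; try exact: (Atr); try exact: (Btr).
- by move=> xy [c [d [Rcd yc dz]]]; exists c, d; split=> //; apply: (Atr) yc.
- move=> [c [d [Rcd xc dy]]] [c' [d' [Rcd' yd' cz']]].
  apply: (Atr) xc _; apply: (Atr) cz'; apply/(Rle _ _ _ _ Rcd Rcd').
  exact: (Btr) yd'.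
- by move=> [c [d [Rcd xc dy]]] yz; exists c, d; split=> //; apply: (Btr) yz.
- by move=> [c [d [Rcd xd cy]]] yz; exists c, d; split=> //; apply: (Atr) yz.
- move=> [c [d [Rcd xd cy]]] [c' [d' [Rcd' yc' dz']]].
  apply: (Btr) xd _; apply: (Btr) dz'; apply/(Rle _ _ _ _ Rcd Rcd').
  exact: (Atr) yc'.
- by move=> xy [c [d [Rcd yd cz]]]; exists c, d; split=> //; apply: (Btr) yd.
Qed.

Lemma free_le_R a b : R a b -> free_le (inl a) (inr b) /\ free_le (inr b) (inl a).
Proof.
have [[Arefl _ _] [Brefl _ _]] := (Apo, Bpo).
by move=> Rab; split; exists a, b; split.
Qed.

Lemma free_le_preserving g : order_preserving A g -> order_preserving B g ->
  forall x y, free_le x y -> free_le (sum_op g x) (sum_op g y).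
Proof.
have [_ Rop] := Riso; move=> Ag Bg [a|b] [a'|b'] /=; try exact: Ag; try exact: Bg.
all: move=> [c [d [/Rop Rcd ? ?]]]; exists (sop g c), (sop g d); split=> //; first [exact: Ag|exact: Bg].
Qed.

Lemma free_le_reversing g : order_reversing A g -> order_reversing B g ->
  forall x y, free_le x y -> free_le (sum_op g y) (sum_op g x).
Proof.
have [_ Rop] := Riso; move=> Ag Bg [a|b] [a'|b'] /=; try exact: Ag; try exact: Bg.
all: move=> [c [d [/Rop Rcd ? ?]]]; exists (sop g c), (sop g d); split=> //; first [exact: Ag|exact: Bg].
Qed.

(** The cycle [a <= c], [d <= b <= d'], [c' <= a] through two related pairs collapses to [a = c] and
    [b = d]. The quotient therefore glues related points only, and every operation respects the
    gluing, monotone or not. *)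
Lemma free_le_eqv_R a b : free_le (inl a) (inr b) -> free_le (inr b) (inl a) -> R a b.
Proof.
have [[_ Aanti Atr] [_ Banti Btr]] := (Apo, Bpo); have [Rle _] := Riso.
move=> [c [d [Rcd ac db]]] [c' [d' [Rcd' bd' ca']]].
have dd' : sle d d' by apply: (Btr) bd'.
have cc' : sle c c' by apply/(Rle _ _ _ _ Rcd Rcd').
have c'c : sle c' c by apply: (Atr) ac.
have d'd : sle d' d by apply/(Rle _ _ _ _ Rcd' Rcd).
rewrite (Aanti _ _ ac); last exact: (Atr) ca'.
by rewrite (Banti _ _ _ db) //; apply: (Btr) d'd.
Qed.

Lemma free_le_op g x y : free_le x y -> free_le y x ->
  free_le (sum_op g x) (sum_op g y).
Proof.
have [[Arefl Aanti _] [Brefl Banti _]] := (Apo, Bpo); have [_ Rop] := Riso.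
case: x y => [a|b] [a'|b'] xy yx.
- by rewrite (Aanti _ _ xy yx); apply: Arefl.
- by have := free_le_R (Rop g _ _ (free_le_eqv_R xy yx)) => -[].
- by have := free_le_R (Rop g _ _ (free_le_eqv_R yx xy)) => -[].
- by rewrite (Banti _ _ xy yx); apply: Brefl.
Qed.

(** Everything that does not depend on the order chosen on the sum: [L] is the free order for posets
    and a linearisation of it for chains. The last hypothesis leaves only the axioms of [K0] to be
    checked. *)
Lemma amalgam (K0 : set (structure F)) (H : set (set (structure F)))
    (L : A + B -> A + B -> Prop) :
  (forall c, H c -> expressible_one_universal c) ->
  finite_members (satisfying K0 H) A -> finite_members (satisfying K0 H) B ->
  preorder L ->
  (forall g x y, L x y -> L y x -> L (sum_op g x) (sum_op g y)) ->
  (forall a a', L (inl a) (inl a') <-> sle a a') ->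
  (forall b b', L (inr b) (inr b') <-> sle b b') ->
  (forall a b, R a b -> L (inl a) (inr b) /\ L (inr b) (inl a)) ->
  (forall D (pi : A + B -> D), (forall d, exists x, pi x = d) ->
     (forall x y, sle (pi x) (pi y) <-> L x y) ->
     (forall g x, pi (sum_op g x) = sop g (pi x)) -> partial_order D -> K0 D) ->
  exists D (u : A -> D) (v : B -> D),
    [/\ finite_members (satisfying K0 H) D, embedding u, embedding v
      & forall a b, R a b -> u a = v b].
Proof.
move=> H1 [[_ AH] Afin] [[_ BH] Bfin] Lpre Lop LA LB LR toK0.
have inhX : inhabited (A + B) by have [a] := carrier_inhabited A; exists; left.
have [D [pi [pi_surj pi_le pi_op Dpo]]] := preorder_quotient inhX Lpre Lop.
have eu : embedding (pi \o inl).
  apply: embedding_poset => //= [x y|g x]; first by rewrite pi_le.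
  by rewrite -pi_op.
have ev : embedding (pi \o inr).
  apply: embedding_poset => //= [x y|g x]; first by rewrite pi_le.
  by rewrite -pi_op.
exists D, (pi \o inl), (pi \o inr); split=> //; last first.
  by move=> a b /LR[ab ba]; have [_ Danti _] := Dpo; apply: Danti; apply/pi_le.
split; first split.
- exact: toK0 pi_surj pi_le pi_op Dpo.
- move=> c Hc; have [p [p1 cp]] := H1 c Hc; apply/cp/(holds_one_universal p1) => d.
  have [[a|b] <-] := pi_surj d.
    by exists A, (pi \o inl); split=> //; [apply/cp; exact: AH|exists a].
  by exists B, (pi \o inr); split=> //; [apply/cp; exact: BH|exists b].
- have [/finite_setE_In[sA inA] /finite_setE_In[sB inB]] := (Afin, Bfin).
  apply/finite_setE_In; exists (List.map (pi \o inl) sA ++ List.map (pi \o inr) sB) => d _.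
  have [[a|b] <-] := pi_surj d; apply/List.in_app_iff; [left|right].
    exact: (List.in_map (pi \o inl) _ _ (inA a I)).
  exact: (List.in_map (pi \o inr) _ _ (inB b I)).
Qed.

End Amalgam.
End PartialIsomorphisms.

(** * The classes of the theorem *)

Section Classes.
Variable F : Type.
Implicit Types (A B D : structure F) (K : set (structure F)).

Definition hereditary K : Prop :=
  forall A B (h : A -> B), embedding h -> K B -> K A.

(** Three points, because transitivity has three variables. This carries membership in a class from
    the finite stages of a chain to their union. *)
Definition locally_determined K : Prop :=
  forall B, (forall x y z : B, exists A (h : A -> B),
    [/\ embedding h, K A & exists a b c, [/\ h a = x, h b = y & h c = z]]) -> K B.

Lemma satisfying_hereditary K (H : set (set (structure F))) :
  (forall c, H c -> expressible_one_universal c) ->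
  hereditary K -> hereditary (satisfying K H).
Proof.
move=> H1 Kher A B h eh [KB HB]; split; first exact: (Kher _ _ _ eh KB).
move=> c Hc; have [p [[ps pu pn] cp]] := H1 c Hc.
by apply/cp/(holds_universal eh pu)/cp; exact: HB.
Qed.

Lemma satisfying_locally_determined K (H : set (set (structure F))) :
  (forall c, H c -> expressible_one_universal c) ->
  locally_determined K -> locally_determined (satisfying K H).
Proof.
move=> H1 Kloc B loc; split.
  by apply: Kloc => x y z; have [A [h [eh [KA _] ?]]] := loc x y z; exists A, h.
move=> c Hc; have [p [p1 cp]] := H1 c Hc; apply/cp/(holds_one_universal p1) => x.
have [A [h [eh [_ HA] [a [_ [_ [ha _ _]]]]]]] := loc x x x.
by exists A, h; split=> //; [apply/cp; exact: HA|exists a].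
Qed.

Lemma partial_order_hereditary : hereditary (@partial_order F).
Proof.
move=> A B h [h_inj h_le _] [Brefl Banti Btr]; split=> [x|x y|x y z].
- exact/h_le/Brefl.
- by move=> /h_le xy /h_le yx; apply: h_inj; apply: Banti.
- by move=> /h_le xy /h_le yz; apply/h_le; apply: Btr yz.
Qed.

Lemma partial_order_locally_determined : locally_determined (@partial_order F).
Proof.
move=> B loc; split=> [x|x y|x y z].
- have [A [h [[_ h_le _] [Ar _ _] [a [_ [_ [<- _ _]]]]]]] := loc x x x.
  exact/h_le/Ar.
- have [A [h [[_ h_le _] [_ Aa _] [a [b [_ [<- <- _]]]]]]] := loc x y y.
  by move=> /h_le ab /h_le ba; congr h; apply: Aa.
- have [A [h [[_ h_le _] [_ _ At] [a [b [c [<- <- <-]]]]]]] := loc x y z.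
  by move=> /h_le ab /h_le bc; apply/h_le; apply: At bc.
Qed.

Lemma linear_order_hereditary : hereditary (@linear_order F).
Proof.
move=> A B h eh [Bpo Btot]; split; first exact: (partial_order_hereditary eh).
by case: eh => _ h_le _ x y; rewrite -!h_le.
Qed.

Lemma linear_order_locally_determined : locally_determined (@linear_order F).
Proof.
move=> B loc; split.
  apply: partial_order_locally_determined => x y z.
  by have [A [h [eh [Apo _] ?]]] := loc x y z; exists A, h.
move=> x y; have [A [h [[_ h_le _] [_ At] [a [b [_ [<- <- _]]]]]]] := loc x y y.
by rewrite !h_le.
Qed.

Lemma strict_preserving_weak A g : partial_order A ->
  strict_order_preserving A g -> order_preserving A g.
Proof.
move=> [Ar _ _] Ag x y xy; have [->|nxy] := EM (x = y); first exact: Ar.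
by have [] : slt (sop g x) (sop g y) by apply: Ag.
Qed.

Lemma strict_reversing_weak A g : partial_order A ->
  strict_order_reversing A g -> order_reversing A g.
Proof.
move=> [Ar _ _] Ag x y xy; have [->|nxy] := EM (x = y); first exact: Ar.
by have [] : slt (sop g y) (sop g x) by apply: Ag.
Qed.

Lemma order_preserving_hereditary g : hereditary (fun A => order_preserving A g).
Proof. by move=> A B h [_ h_le h_op] Bg x y /h_le/Bg; rewrite -!h_op h_le. Qed.

Lemma order_reversing_hereditary g : hereditary (fun A => order_reversing A g).
Proof. by move=> A B h [_ h_le h_op] Bg x y /h_le/Bg; rewrite -!h_op h_le. Qed.

Lemma slt_embedding A B (h : A -> B) x y : embedding h -> slt (h x) (h y) <-> slt x y.
Proof.
move=> [h_inj h_le _]; rewrite /slt h_le.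
by split=> -[xy nxy]; split=> //; [move=> E; apply: nxy; rewrite E|move/h_inj].
Qed.

Lemma strict_order_preserving_hereditary g :
  hereditary (fun A => strict_order_preserving A g).
Proof.
move=> A B h eh Bg x y /(slt_embedding _ _ eh)/Bg.
by have [_ _ h_op] := eh; rewrite -!h_op (slt_embedding _ _ eh).
Qed.

Lemma strict_order_reversing_hereditary g :
  hereditary (fun A => strict_order_reversing A g).
Proof.
move=> A B h eh Bg x y /(slt_embedding _ _ eh)/Bg.
by have [_ _ h_op] := eh; rewrite -!h_op (slt_embedding _ _ eh).
Qed.

Lemma order_preserving_locally_determined g :
  locally_determined (fun A => order_preserving A g).
Proof.
move=> B loc x y.
have [A [h [[_ h_le h_op] Ag [a [b [_ [<- <- _]]]]]]] := loc x y y.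
by move=> /h_le/Ag; rewrite -!h_op h_le.
Qed.

Lemma order_reversing_locally_determined g :
  locally_determined (fun A => order_reversing A g).
Proof.
move=> B loc x y.
have [A [h [[_ h_le h_op] Ag [a [b [_ [<- <- _]]]]]]] := loc x y y.
by move=> /h_le/Ag; rewrite -!h_op h_le.
Qed.

Lemma strict_order_preserving_locally_determined g :
  locally_determined (fun A => strict_order_preserving A g).
Proof.
move=> B loc x y; have [A [h [eh Ag [a [b [_ [<- <- _]]]]]]] := loc x y y.
by have [_ _ h_op] := eh; move/(slt_embedding _ _ eh)/Ag; rewrite -!h_op (slt_embedding _ _ eh).
Qed.

Lemma strict_order_reversing_locally_determined g :
  locally_determined (fun A => strict_order_reversing A g).
Proof.
move=> B loc x y; have [A [h [eh Ag [a [b [_ [<- <- _]]]]]]] := loc x y y.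
by have [_ _ h_op] := eh; move/(slt_embedding _ _ eh)/Ag; rewrite -!h_op (slt_embedding _ _ eh).
Qed.

Lemma hereditaryI K K' : hereditary K -> hereditary K' -> hereditary (K `&` K').
Proof. by move=> Kh Kh' A B h eh [KB KB']; split; [apply: (Kh _ _ _ eh)|apply: (Kh' _ _ _ eh)]. Qed.

Lemma locally_determinedI K K' :
  locally_determined K -> locally_determined K' -> locally_determined (K `&` K').
Proof.
move=> Kl Kl' B loc; split; [apply: Kl|apply: Kl'] => x y z.
all: by have [A [h [eh [? ?] ?]]] := loc x y z; exists A, h.
Qed.

Lemma hereditary_bigI (I : Type) (P : set I) (K : I -> set (structure F)) :
  (forall i, hereditary (K i)) -> hereditary (\bigcap_(i in P) K i).
Proof. by move=> Kh A B h eh KB i Pi; apply: (Kh i A B h eh); apply: KB. Qed.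

Lemma locally_determined_bigI (I : Type) (P : set I) (K : I -> set (structure F)) :
  (forall i, locally_determined (K i)) -> locally_determined (\bigcap_(i in P) K i).
Proof.
move=> Kl B loc i Pi; apply: Kl => x y z.
by have [A [h [eh KA ?]]] := loc x y z; exists A, h; split=> //; apply: KA.
Qed.

End Classes.

Lemma PO_bigcap (F : finType) (F1 F2 F3 F4 : {set F}) : PO F1 F2 F3 F4 =
  @partial_order F `&`
   (\bigcap_(g in [set` F1]) (fun A => order_preserving A g) `&`
   (\bigcap_(g in [set` F2]) (fun A => order_reversing A g) `&`
   (\bigcap_(g in [set` F3]) (fun A => strict_order_preserving A g) `&`
    \bigcap_(g in [set` F4]) (fun A => strict_order_reversing A g)))).
Proof.
by apply/seteqP; split=> A [Apo]; [move=> [h1 h2 h3 h4]|move=> [h1 [h2 [h3 h4]]]].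
Qed.

Lemma PO_hereditary (F : finType) (F1 F2 F3 F4 : {set F}) :
  hereditary (PO F1 F2 F3 F4).
Proof.
rewrite PO_bigcap; apply: hereditaryI; first exact: partial_order_hereditary.
do 3?apply: hereditaryI; apply: hereditary_bigI => g.
- exact: order_preserving_hereditary.
- exact: order_reversing_hereditary.
- exact: strict_order_preserving_hereditary.
- exact: strict_order_reversing_hereditary.
Qed.

Lemma PO_locally_determined (F : finType) (F1 F2 F3 F4 : {set F}) :
  locally_determined (PO F1 F2 F3 F4).
Proof.
rewrite PO_bigcap; apply: locally_determinedI.
  exact: partial_order_locally_determined.
do 3?apply: locally_determinedI; apply: locally_determined_bigI => g.
- exact: order_preserving_locally_determined.
- exact: order_reversing_locally_determined.
- exact: strict_order_preserving_locally_determined.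
- exact: strict_order_reversing_locally_determined.
Qed.

Lemma LO_p_hereditary : hereditary LO_p.
Proof.
exact: hereditaryI (@linear_order_hereditary unit) (@order_preserving_hereditary _ tt).
Qed.

Lemma LO_r_hereditary : hereditary LO_r.
Proof.
exact: hereditaryI (@linear_order_hereditary unit) (@order_reversing_hereditary _ tt).
Qed.

Lemma LO_p_locally_determined : locally_determined LO_p.
Proof.
exact: locally_determinedI (@linear_order_locally_determined unit)
  (@order_preserving_locally_determined _ tt).
Qed.

Lemma LO_r_locally_determined : locally_determined LO_r.
Proof.
exact: locally_determinedI (@linear_order_locally_determined unit)
  (@order_reversing_locally_determined _ tt).
Qed.

(** Strictness across the two sides follows from strictness within each. If [a <= c] and [d <= b]
    with [R c d], and [L] also puts [b] below [a], then all four are equivalent under [L]; hence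
    [c <= a] in [A] and [b <= d] in [B], which puts [b] below [a] in the free order. *)
Lemma free_le_refines (F : Type) (A B : structure F) (R : A -> B -> Prop)
    (L : A + B -> A + B -> Prop) :
  partial_order A -> partial_order B -> piso R -> preorder L ->
  (forall x y, free_le R x y -> L x y) ->
  (forall a a', sle a a' -> L (inl a') (inl a) -> sle a' a) ->
  (forall b b', sle b b' -> L (inr b') (inr b) -> sle b' b) ->
  refines (free_le R) L.
Proof.
move=> Apo Bpo Riso [_ Ltr] freeL LA LB; split=> //.
have Ri a b : R a b -> L (inl a) (inr b) /\ L (inr b) (inl a).
  by move=> /(free_le_R Apo Bpo)[/freeL ? /freeL].
move=> [a|b] [a'|b'] /=; [exact: LA| | |exact: LB].
- move=> [c [d [Rcd ac db]]] ba; have [cd dc] := Ri _ _ Rcd.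
  have ca : L (inl c) (inl a).
    by apply: (Ltr) cd _; apply: (Ltr) ba; apply: freeL.
  have bd : L (inr b') (inr d).
    by apply: (Ltr) ba _; apply: (Ltr) cd; apply: freeL.
  by exists c, d; split=> //; [apply: LB|apply: LA].
- move=> [c [d [Rcd bd ca]]] ab; have [cd dc] := Ri _ _ Rcd.
  have db : L (inr d) (inr b).
    by apply: (Ltr) dc _; apply: (Ltr) ab; apply: freeL.
  have ac : L (inl a') (inl c).
    by apply: (Ltr) ab _; apply: (Ltr) dc; apply: freeL.
  by exists c, d; split=> //; [apply: LA|apply: LB].
Qed.

(** * Monotone and strict operations on the free amalgam *)

Section FreeAmalgam.
Variables (F : Type) (A B D : structure F) (R : A -> B -> Prop) (pi : A + B -> D).
Hypotheses (Apo : partial_order A) (Bpo : partial_order B) (Riso : piso R).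
Hypotheses (pi_surj : forall d, exists x, pi x = d)
  (pi_le : forall x y, sle (pi x) (pi y) <-> free_le R x y)
  (pi_op : forall g x, pi (sum_op g x) = sop g (pi x)) (Dpo : partial_order D).

Lemma free_amalgam_preserving g :
  order_preserving A g -> order_preserving B g -> order_preserving D g.
Proof.
move=> Ag Bg d e; have [[x <-] [y <-]] := (pi_surj d, pi_surj e).
by rewrite -!pi_op !pi_le; apply: free_le_preserving.
Qed.

Lemma free_amalgam_reversing g :
  order_reversing A g -> order_reversing B g -> order_reversing D g.
Proof.
move=> Ag Bg d e; have [[x <-] [y <-]] := (pi_surj d, pi_surj e).
by rewrite -!pi_op !pi_le; apply: free_le_reversing.
Qed.

Lemma free_amalgam_strict_preserving g : strict_order_preserving A g ->
  strict_order_preserving B g -> strict_order_preserving D g.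
Proof.
move=> Ag Bg; have [Ag' Bg'] := (strict_preserving_weak Apo Ag, strict_preserving_weak Bpo Bg).
have [Dr Da Dt] := Dpo.
(* A monotone [g] is strict when the order pulled back along it collapses no strict inequality, that
   is, when the pullback refines the free order. *)
have refD : refines (free_le R) (fun x y => free_le R (sum_op g x) (sum_op g y)).
  apply: free_le_refines => //.
  - have [Lr Lt] := free_le_preorder Apo Bpo Riso.
    by split=> [x|x y z]; [apply: Lr|apply: Lt].
  - exact: free_le_preserving.
  - move=> a a' aa' /= ga; have [->|naa'] := EM (a = a'); first by have [Ar _ _] := Apo.
    have [_ []] : slt (sop g a) (sop g a') by apply: Ag.
    by have [_ Aa _] := Apo; apply: Aa => //; apply: Ag'.
  - move=> a a' aa' /= ga; have [->|naa'] := EM (a = a'); first by have [Br _ _] := Bpo.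
    have [_ []] : slt (sop g a) (sop g a') by apply: Bg.
    by have [_ Ba _] := Bpo; apply: Ba => //; apply: Bg'.
move=> d e; have [[x <-] [y <-]] := (pi_surj d, pi_surj e).
move=> [xy nxy]; split; first exact: free_amalgam_preserving.
move=> gxy; apply: nxy; apply: Da => //; apply/pi_le/(refD.2 x y); first exact/pi_le.
by apply/pi_le; rewrite !pi_op gxy.
Qed.

Lemma free_amalgam_strict_reversing g : strict_order_reversing A g ->
  strict_order_reversing B g -> strict_order_reversing D g.
Proof.
move=> Ag Bg; have [Ag' Bg'] := (strict_reversing_weak Apo Ag, strict_reversing_weak Bpo Bg).
have [Dr Da Dt] := Dpo.
have refD : refines (free_le R) (fun x y => free_le R (sum_op g y) (sum_op g x)).
  apply: free_le_refines => //.
  - have [Lr Lt] := free_le_preorder Apo Bpo Riso.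
    by split=> [x|x y z yx zy]; [apply: Lr|apply: Lt zy yx].
  - exact: free_le_reversing.
  - move=> a a' aa' /= ga; have [->|naa'] := EM (a = a'); first by have [Ar _ _] := Apo.
    have [_ []] : slt (sop g a') (sop g a) by apply: Ag.
    by have [_ Aa _] := Apo; apply: Aa => //; apply: Ag'.
  - move=> a a' aa' /= ga; have [->|naa'] := EM (a = a'); first by have [Br _ _] := Bpo.
    have [_ []] : slt (sop g a') (sop g a) by apply: Bg.
    by have [_ Ba _] := Bpo; apply: Ba => //; apply: Bg'.
move=> d e; have [[x <-] [y <-]] := (pi_surj d, pi_surj e).
move=> [xy nxy]; split; first exact: free_amalgam_reversing.
move=> gxy; apply: nxy; apply: Da => //; apply/pi_le/(refD.2 x y); first exact/pi_le.
by apply/pi_le; rewrite !pi_op gxy.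
Qed.

End FreeAmalgam.

Lemma PO_amalgamation (F : finType) (F1 F2 F3 F4 : {set F})
    (H : set (set (structure F))) :
  (forall c, H c -> expressible_one_universal c) ->
  amalgamation (satisfying (PO F1 F2 F3 F4) H).
Proof.
move=> H1 A B R KA KB Riso.
have [[[Apo [A1 A2 A3 A4]] _] _] := KA; have [[[Bpo [B1 B2 B3 B4]] _] _] := KB.
apply: (amalgam (L := free_le R) Apo Bpo H1 KA KB) => //.
- exact: free_le_preorder.
- by move=> g x y; apply: free_le_op.
- by move=> a b; apply: free_le_R.
move=> D pi pi_surj pi_le pi_op Dpo; split=> //.
split=> g Fg.
- by apply: (free_amalgam_preserving Riso pi_surj pi_le); [|apply: A1|apply: B1].
- by apply: (free_amalgam_reversing Riso pi_surj pi_le); [|apply: A2|apply: B2].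
- by apply: (free_amalgam_strict_preserving Apo Bpo Riso pi_surj pi_le); [| |apply: A3|apply: B3].
- by apply: (free_amalgam_strict_reversing Apo Bpo Riso pi_surj pi_le); [| |apply: A4|apply: B4].
Qed.

(** * Amalgams of finite chains *)

Lemma iter_collision (T : Type) (f : T -> T) x : finite_set [set: T] ->
  exists i j, (i < j)%N /\ iter i f x = iter j f x.
Proof.
move=> Tfin; apply: contrapT => ncol; apply: infinite_nat.
rewrite -(preimage_setT (fun i => iter i f x)); apply: finite_preimage => // i j _ _ ij.
by have [lt|lt|//] := ltngtP i j; case: ncol; [exists i, j|exists j, i].
Qed.

Section FiniteChains.
Variable A : structure unit.
Hypotheses (Alin : linear_order A) (Afin : finite_set [set: A]).

(** An orbit in a chain ascends or descends, so once it returns to a point it is constant there. The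
    map is arbitrary so that, in a reversing chain, the square of the operation can be taken. *)
Lemma preserving_eventually_fixed (h : A -> A) x :
  (forall y z, sle y z -> sle (h y) (h z)) ->
  exists n, h (iter n h x) = iter n h x.
Proof.
move=> hm; have [i [j [ij hij]]] := iter_collision h x Afin; exists i.
have [[Ar Aa At] Atot] := Alin.
have up y n : sle y (h y) -> sle y (iter n h y).
  by move=> yh; elim: n => [|n IHn] //=; apply: (At) yh _; apply: hm.
have dn y n : sle (h y) y -> sle (iter n h y) y.
  by move=> hy; elim: n => [|n IHn] //=; apply: (At) hy; apply: hm.
have hj : iter j h x = iter (j - i.+1) h (h (iter i h x)).
  by rewrite -iterS -iterD subnK.
apply: Aa; case: (Atot (iter i h x) (h (iter i h x))) => cmp //.
- by rewrite [X in sle _ X]hij hj; apply: up; apply: hm.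
- by rewrite [X in sle X _]hij hj; apply: dn; apply: hm.
Qed.

End FiniteChains.

Lemma finite_set_sum (A B : Type) : finite_set [set: A] -> finite_set [set: B] ->
  finite_set [set: A + B].
Proof.
move=> /finite_setE_In[s sA] /finite_setE_In[t tB].
apply/finite_setE_In; exists (List.map inl s ++ List.map inr t) => -[a|b] _.
- by apply/List.in_app_iff; left; apply/List.in_map/sA.
- by apply/List.in_app_iff; right; apply/List.in_map/tB.
Qed.

Lemma iter_sum_op (A B : structure unit) n :
  (forall a : A, iter n (@sum_op _ A B tt) (inl a) = inl (iter n (sop tt) a)) /\
  (forall b : B, iter n (@sum_op _ A B tt) (inr b) = inr (iter n (sop tt) b)).
Proof. by elim: n => [|n [IHa IHb]]; split=> //= x; rewrite ?IHa ?IHb. Qed.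

Lemma refines_linear (A B : structure unit) (R : A -> B -> Prop) L :
  linear_order A -> linear_order B -> refines (free_le R) L ->
  (forall a a', L (inl a) (inl a') <-> sle a a') /\
  (forall b b', L (inr b) (inr b') <-> sle b b').
Proof.
move=> [_ At] [_ Bt] [L1 L2]; split=> a a'; split=> aa'.
- by case: (At a a') => // a'a; apply: (L2 (inl a') (inl a)).
- exact: (L1 (inl a) (inl a')).
- by case: (Bt a a') => // a'a; apply: (L2 (inr a') (inr a)).
- exact: (L1 (inr a) (inr a')).
Qed.

Lemma LO_p_amalgamation (H : set (set (structure unit))) :
  (forall c, H c -> expressible_one_universal c) ->
  amalgamation (satisfying LO_p H).
Proof.
move=> H1 A B R KA KB Riso.
have [[[Alin Af] _] Afin] := KA; have [[[Blin Bf] _] Bfin] := KB.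
have [[Apo _] [Bpo _]] := (Alin, Blin).
have fixX x : exists n, @sum_op _ A B tt (iter n (sum_op tt) x) = iter n (sum_op tt) x.
  case: x => [a|b].
  - have [n an] := preserving_eventually_fixed Alin Afin a Af.
    by exists n; rewrite (iter_sum_op A B n).1 /= an.
  - have [n bn] := preserving_eventually_fixed Blin Bfin b Bf.
    by exists n; rewrite (iter_sum_op A B n).2 /= bn.
have [|||L [[Lpre Lf] LL Ltot]] := @refines_total _ (preserving_preorder (sum_op tt)) _ _ (free_le R).
- exact: finite_set_sum.
- by move=> L GL a b; apply: preserving_comparable.
- by split; [apply: free_le_preorder|apply: free_le_preserving].
have [LA LB] := refines_linear Alin Blin LL.
apply: (amalgam (L := L) Apo Bpo H1 KA KB) => //.
- by move=> [] x y /Lf.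
- by move=> a b /(free_le_R Apo Bpo)[/LL.1 ? /LL.1].
move=> D pi pi_surj pi_le pi_op Dpo; split; first split=> //.
- by move=> d e; have [[x <-] [y <-]] := (pi_surj d, pi_surj e); rewrite !pi_le.
- move=> d e; have [[x <-] [y <-]] := (pi_surj d, pi_surj e).
  by rewrite -!pi_op !pi_le; apply: Lf.
Qed.

(** The side of the fixed point on which [x] lies is read off from [x] and its image alone;
    corresponding elements of two chains thus lie on the same side of their fixed points. *)
Lemma reversing_le_fixpoint (A : structure unit) (p x : A) :
  linear_order A -> order_reversing A tt -> sop tt p = p ->
  (sle x p <-> sle x (sop tt x)) /\ (sle p x <-> sle (sop tt x) x).
Proof.
move=> [[Ar Aa At] Atot] Af fp; split; split.
- by move=> xp; have := Af _ _ xp; rewrite fp; apply: At.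
- by move=> xf; case: (Atot x p) => // /Af; rewrite fp => fxp; apply: At fxp.
- by move=> px; have := Af _ _ px; rewrite fp => fxp; apply: At px.
- by move=> fx; case: (Atot p x) => // /Af; rewrite fp => pf; apply: At fx.
Qed.

Lemma LO_r_amalgamation (H : set (set (structure unit))) :
  (forall c, H c -> expressible_one_universal c) ->
  amalgamation (satisfying LO_r H).
Proof.
move=> H1 A B R0 KA KB [R0le R0op].
have [[[Alin Af] _] Afin] := KA; have [[[Blin Bf] _] Bfin] := KB.
have [[Apo _] [Bpo _]] := (Alin, Blin).
have [[Ar Aa At] [Br Ba Bt]] := (Apo, Bpo).
(* A reversing map on a chain has at most one fixed point, and its position is
   determined; so fixed points of [A] and [B] must be, and can be, identified. *)
pose R a b := R0 a b \/ sop tt a = a /\ sop tt b = b.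
have Riso : piso R.
  split=> [a a' b b'|[] a b]; last first.
    by case=> [/(R0op tt)|[fa fb]]; [left|right; rewrite !fa !fb].
  case=> [ab|[fa fb]] [ab'|[fa' fb']].
  - exact: R0le.
  - rewrite (reversing_le_fixpoint a Alin Af fa').1 (reversing_le_fixpoint b Blin Bf fb').1.
    by apply: R0le => //; apply: R0op.
  - rewrite (reversing_le_fixpoint a' Alin Af fa).2 (reversing_le_fixpoint b' Blin Bf fb).2.
    by apply: R0le => //; apply: R0op.
  - rewrite (reversing_le_fixpoint a Alin Af fa').1 (reversing_le_fixpoint b Blin Bf fb').1.
    by rewrite fa fb; split=> _; [apply: Br|apply: Ar].
have perX x : exists n, @sum_op _ A B tt (sum_op tt (iter n (sum_op tt) x)) =
    iter n (sum_op tt) x.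
  case: x => [a|b].
  - have [|n an] := @preserving_eventually_fixed A Alin Afin (fun y => sop tt (sop tt y)) a.
      by move=> y z yz; exact: (Af _ _ (Af _ _ yz)).
    (* [n] counts steps of the square of the operation. *)
    exists n.*2; rewrite (iter_sum_op A B _).1 /=; congr inl; move: an.
    by rewrite -mul2n mulnC iterM.
  - have [|n bn] := @preserving_eventually_fixed B Blin Bfin (fun y => sop tt (sop tt y)) b.
      by move=> y z yz; exact: (Bf _ _ (Bf _ _ yz)).
    exists n.*2; rewrite (iter_sum_op A B _).2 /=; congr inr; move: bn.
    by rewrite -mul2n mulnC iterM.
have [|||L [[Lpre Lf _ _] LL Ltot]] := @refines_total _ (reversing_preorder (sum_op tt)) _ _ (free_le R).
- exact: finite_set_sum.
- by move=> L GL a b; apply: reversing_comparable.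
- split; [exact: free_le_preorder|exact: free_le_reversing| |].
  + by case=> [a|b]; [apply: Alin.2|apply: Blin.2].
  + have eqA (a : A) : sle a (sop tt a) -> sle (sop tt a) a -> sop tt a = a by move=> ? ?; apply: Aa.
    have eqB (b : B) : sle b (sop tt b) -> sle (sop tt b) b -> sop tt b = b by move=> ? ?; apply: Ba.
    case=> [a|b] [a'|b'] /= x1 x2 y1 y2.
    * by apply/(reversing_le_fixpoint a Alin Af (eqA a' y1 y2)).1.
    * have Rab : R a b' by right; split; [apply: eqA|apply: eqB].
      by case: (free_le_R Apo Bpo Rab).
    * have Rab : R a' b by right; split; [apply: eqA|apply: eqB].
      by case: (free_le_R Apo Bpo Rab).
    * by apply/(reversing_le_fixpoint b Blin Bf (eqB b' y1 y2)).1.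
have [LA LB] := refines_linear Alin Blin LL.
have [|||D [u [v [KD eu ev uv]]]] := amalgam (L := L) (R := R) Apo Bpo H1 KA KB Lpre _ LA LB.
- by move=> [] x y _ /Lf.
- by move=> a b /(free_le_R Apo Bpo)[/LL.1 ? /LL.1].
- move=> D pi pi_surj pi_le pi_op Dpo; split; first split=> //.
  + by move=> d e; have [[x <-] [y <-]] := (pi_surj d, pi_surj e); rewrite !pi_le.
  + move=> d e; have [[x <-] [y <-]] := (pi_surj d, pi_surj e).
    by rewrite -!pi_op !pi_le; apply: Lf.
by exists D, u, v; split=> // a b ab; apply: uv; left.
Qed.

(** * Back-and-forth and direct limits *)

Lemma countable_enum (T : Type) : inhabited T -> countable [set: T] ->
  exists e : nat -> T, forall x, exists n, e n = x.
Proof.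
move=> [x0] /countable_injP[f f_inj].
have ex n : exists x, (exists y, f y = n) -> f x = n.
  have [[y yn]|no] := EM (exists y, f y = n); first by exists y.
  by exists x0 => /no.
exists (fun n => sval (cid (ex n))) => x; exists (f x); case: cid => y /= fy.
by apply: f_inj; rewrite ?in_setT //; apply: fy; exists x.
Qed.

(** The relations in [P] need not be closed under the operations, as they may list finite tuples
    only; the last clause of the first condition on [P] therefore concerns just those values of an
    operation that occur in the relation. *)
Lemma back_and_forth (F : Type) (A B : structure F)
    (P : (A -> B -> Prop) -> Prop) (R0 : A -> B -> Prop) :
  countable [set: A] -> countable [set: B] ->
  (forall R, P R -> forall a a' b b', R a b -> R a' b' ->
     [/\ sle a a' <-> sle b b', a = a' <-> b = b'
       & forall g, sop g a = a' -> sop g b = b']) ->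
  (forall R, P R -> forall a, exists R',
     [/\ P R', forall x y, R x y -> R' x y & exists b, R' a b]) ->
  (forall R, P R -> forall b, exists R',
     [/\ P R', forall x y, R x y -> R' x y & exists a, R' a b]) ->
  P R0 -> exists h : A -> B, isomorphism h /\ forall a b, R0 a b -> h a = b.
Proof.
move=> /(countable_enum (carrier_inhabited A))[eA eAP].
move=> /(countable_enum (carrier_inhabited B))[eB eBP] Ploc forth back PR0.
have ext (s : {R | P R} * nat) : exists s' : {R | P R},
    [/\ forall x y, sval s.1 x y -> sval s' x y,
        exists b, sval s' (eA s.2) b & exists a, sval s' a (eB s.2)].
  case: s => [[R PR] n] /=.
  have [R' [PR' RR' [b ab]]] := forth R PR (eA n).
  have [R'' [PR'' RR'' ba]] := back R' PR' (eB n).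
  by exists (exist _ R'' PR''); split=> //= [x y /RR'/RR''//|]; exists b; apply: RR''.
have [next nextP] := choice ext.
pose ch := fix ch n := if n is k.+1 then next (ch k, k) else exist P R0 PR0.
have ch_mono m n : (m <= n)%N -> forall x y, sval (ch m) x y -> sval (ch n) x y.
  elim: n => [|n IHn]; first by rewrite leqn0 => /eqP->.
  rewrite leq_eqVlt => /orP[/eqP->//|/IHn IH x y /IH].
  by have [+ _ _] := nextP (ch n, n); apply.
pose U x y := exists n, sval (ch n) x y.
have Uloc a a' b b' : U a b -> U a' b' ->
    [/\ sle a a' <-> sle b b', a = a' <-> b = b' & forall g, sop g a = a' -> sop g b = b'].
  move=> [m ab] [n ab']; apply: (Ploc _ (svalP (ch (maxn m n)))).
  - by apply: (ch_mono) ab; rewrite leq_maxl.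
  - by apply: (ch_mono) ab'; rewrite leq_maxr.
have Utot a : exists b, U a b.
  have [n <-] := eAP a; have [_ [b ab] _] := nextP (ch n, n).
  by exists b, n.+1.
have Usurj b : exists a, U a b.
  have [n <-] := eBP b; have [_ _ [a ab]] := nextP (ch n, n).
  by exists a, n.+1.
have [h hU] := choice Utot.
have Uh a b : U a b -> h a = b by move=> ab; have [_ [+ _] _] := Uloc _ _ _ _ (hU a) ab; apply.
exists h; split=> [|a b ab]; last by apply: Uh; exists 0.
split=> [|b]; last by have [a /Uh] := Usurj b; exists a.
split=> [x y hxy|x y|g x].
- by have [_ [_ +] _] := Uloc _ _ _ _ (hU x) (hU y); apply.
- by have [-> _ _] := Uloc _ _ _ _ (hU x) (hU y).
- by have [_ _ +] := Uloc _ _ _ _ (hU x) (hU (sop g x)) => /(_ g erefl) ->.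
Qed.

(** * Finite structures on initial segments of the naturals *)

Section Codes.
Variable F : finType.

(* Carriers are subsets of [nat] rather than ordinals ['I_n.+1]: the type
   [ordinal] lives in too large a universe to be the carrier of a structure. *)
Definition seg (n : nat) : Set := {i : nat | (i < n.+1)%N}.

Definition seg_of (n i : nat) : seg n := insubd (exist _ 0 isT) i.

Lemma seg_ofK n i : (i < n.+1)%N -> sval (seg_of n i) = i.
Proof. by move=> lt; rewrite /seg_of -[sval _]/(val _) insubdK. Qed.

(* A code lists the order table and the operation tables of a structure on the
   type [seg n]; out-of-range entries are read as junk. *)
Definition code : countType := (nat * seq (seq bool) * {ffun F -> seq nat})%type.

Definition csize (c : code) : nat := c.1.1.

Definition cstr (c : code) : structure F :=
  @Structure F (seg (csize c))
    (fun x y => nth false (nth [::] c.1.2 (sval x)) (sval y))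
    (fun g x => seg_of (csize c) (nth 0 (c.2 g) (sval x))) (inhabits (seg_of _ 0)).

Definition cval (c : code) (x : cstr c) : nat := sval (x : seg (csize c)).

Lemma cval_inj (c : code) : injective (@cval c).
Proof. exact: val_inj. Qed.

Lemma cval_lt (c : code) (x : cstr c) : (cval x < (csize c).+1)%N.
Proof. exact: (svalP (x : seg (csize c))). Qed.

Lemma cstr_finite (c : code) : finite_set [set: cstr c].
Proof.
apply/finite_setE_In; exists (List.map (seg_of (csize c)) (List.seq 0 (csize c).+1)).
move=> x _; apply/List.in_map_iff; exists (cval x); split.
  by apply: cval_inj; rewrite {1}/cval seg_ofK // cval_lt.
by apply/List.in_seq; split; apply/leP; rewrite ?cval_lt.
Qed.

Definition inc (c c' : code) (x : cstr c) : cstr c' := seg_of (csize c') (cval x).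

Definition code_le (c c' : code) : Prop := (csize c <= csize c')%N /\ embedding (@inc c c').

Lemma cval_inc (c c' : code) (x : cstr c) : (csize c <= csize c')%N ->
  cval (inc c' x) = cval x.
Proof. by move=> cc'; rewrite /cval /inc seg_ofK // (leq_trans (cval_lt x)). Qed.

Lemma code_le_refl (c : code) : code_le c c.
Proof.
split=> //; suff -> : @inc c c = id by split.
by apply/funext => x; apply: cval_inj; rewrite cval_inc.
Qed.

Lemma inc_trans (c c' c'' : code) (x : cstr c) :
  (csize c <= csize c')%N -> (csize c' <= csize c'')%N ->
  inc c'' (inc c' x) = inc c'' x.
Proof.
move=> h1 h2; apply: cval_inj.
by rewrite !cval_inc // (leq_trans h1).
Qed.

Lemma embedding_comp (A B C : structure F) (h : A -> B) (k : B -> C) :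
  embedding h -> embedding k -> embedding (k \o h).
Proof.
move=> [h1 h2 h3] [k1 k2 k3]; split=> [|x y|g x] /=; first exact: inj_comp.
- by rewrite k2 h2.
- by rewrite h3 k3.
Qed.

Lemma code_le_trans (c c' c'' : code) : code_le c c' -> code_le c' c'' -> code_le c c''.
Proof.
move=> [h1 e1] [h2 e2]; split; first exact: leq_trans h2.
suff -> : @inc c c'' = @inc c' c'' \o @inc c c' by apply: embedding_comp.
by apply/funext => x /=; rewrite inc_trans.
Qed.

Lemma isomorphism_inv (A B : structure F) (h : A -> B) : isomorphism h ->
  exists k : B -> A, embedding k /\ forall x, k (h x) = x.
Proof.
move=> [[h1 h2 h3] h_surj]; have [k kP] := choice h_surj.
exists k; split=> [|x]; last by apply: h1; rewrite kP.
split=> [x y kxy|x y|g x]; first by rewrite -(kP x) kxy kP.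
- by rewrite -h2 !kP.
- by apply: h1; rewrite h3 !kP.
Qed.

(** Prescribing the numbers of some points allows an amalgam to be renumbered so that an old
    structure is included with its numbers unchanged. With [n = 0] it merely codes a finite
    structure. *)
Lemma code_extend (B : structure F) n (e : nat -> B) :
  finite_set [set: B] ->
  (forall i j, (i < n.+1)%N -> (j < n.+1)%N -> e i = e j -> i = j) ->
  exists (c : code) (j : B -> cstr c),
    [/\ isomorphism j, (n <= csize c)%N & forall i, (i < n.+1)%N -> cval (j (e i)) = i].
Proof.
move=> /finite_setE_In[s0 s0B] e_inj.
pose T : choiceType := {classic B}.
pose i0 : seq T := mkseq e n.+1.
pose s : seq T := i0 ++ [seq b <- undup (s0 : seq T) | b \notin i0].
have sP (b : T) : b \in s.
  rewrite mem_cat mem_filter mem_undup; case: (b \in i0) => //=.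
  elim: {s s0B}s0 (s0B b I) => //= x t IHt.
  by rewrite inE => -[->|/IHt->]; rewrite ?eqxx ?orbT.
have i0_size : size i0 = n.+1 by rewrite size_mkseq.
have i0_uniq : uniq i0.
  by rewrite map_inj_in_uniq ?iota_uniq // => i j; rewrite !mem_iota; apply: e_inj.
have s_uniq : uniq s.
  rewrite cat_uniq i0_uniq filter_uniq ?undup_uniq // andbT /=.
  by apply/hasPn => x; rewrite mem_filter => /andP[].
have s_size : size s = (size s).-1.+1 by rewrite size_cat i0_size.
pose N := (size s).-1; pose b0 : T := e 0.
pose c : code := (N, mkseq (fun i => mkseq (fun j => `[< sle (nth b0 s i : B) (nth b0 s j) >]) N.+1) N.+1,
  [ffun g => mkseq (fun i => index (sop g (nth b0 s i : B) : T) s) N.+1]).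
have cle i k : (i < N.+1)%N -> (k < N.+1)%N ->
    nth false (nth [::] c.1.2 i) k = `[< sle (nth b0 s i : B) (nth b0 s k) >].
  by move=> iN kN; rewrite !nth_mkseq.
have cop g i : (i < N.+1)%N -> nth 0 (c.2 g) i = index (sop g (nth b0 s i : B) : T) s.
  by move=> iN; rewrite ffunE nth_mkseq.
pose j (b : B) : cstr c := seg_of N (index (b : T) s).
have jE b : cval (j b) = index (b : T) s.
  by rewrite /cval /j seg_ofK // /N -s_size index_mem.
have lt_ind (b : T) : (index b s < N.+1)%N by rewrite /N -s_size index_mem.
exists c, j; split; last 2 first.
- by rewrite /csize /= -ltnS /N -s_size size_cat i0_size leq_addr.
- move=> i lt; rewrite jE index_cat.
  have -> : (e i : T) = nth b0 i0 i by rewrite nth_mkseq.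
  by rewrite mem_nth ?i0_size // index_uniq ?i0_size.
split; last first.
  move=> y; exists (nth b0 s (cval y)); apply: cval_inj; rewrite jE index_uniq //.
  by rewrite s_size; apply: cval_lt.
split=> [x y /(congr1 (@cval c))|x y|g x].
- by rewrite !jE => E; have := nth_index b0 (sP x); rewrite E (nth_index b0 (sP y)).
- change (nth false (nth [::] c.1.2 (cval (j x))) (cval (j y)) <-> sle x y).
  by rewrite !jE cle // !nth_index //; split=> /asboolP.
- apply: cval_inj; rewrite jE.
  change (index (sop g x : T) s = sval (seg_of N (nth 0 (c.2 g) (cval (j x))))).
  by rewrite jE cop // nth_index // seg_ofK.
Qed.

(** * Direct limit of a chain of codes *)

Section Limit.
Variable cs : nat -> code.
Hypotheses (cs_le : forall k, code_le (cs k) (cs k.+1))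
  (cs_po : forall k, partial_order (cstr (cs k))).

Lemma chain_code_le k l : (k <= l)%N -> code_le (cs k) (cs l).
Proof.
elim: l => [|l IHl]; first by rewrite leqn0 => /eqP->; apply: code_le_refl.
rewrite leq_eqVlt => /orP[/eqP->|/IHl kl]; first exact: code_le_refl.
exact: code_le_trans (cs_le l).
Qed.

Lemma chain_inc k l m (y : cstr (cs k)) : (k <= l)%N -> (l <= m)%N ->
  inc (cs m) (inc (cs l) y) = inc (cs m) y.
Proof.
by move=> /chain_code_le[kl _] /chain_code_le[lm _]; apply: inc_trans.
Qed.

Lemma direct_limit : exists (M : structure F) (iota : forall k, cstr (cs k) -> M),
  [/\ countable [set: M], forall k, embedding (iota k),
      forall x, exists k y, iota k y = x
    & forall k l y, (k <= l)%N -> iota l (inc (cs l) y) = iota k y].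
Proof.
pose X := {k : nat & seg (csize (cs k))}.
pose at_ m (x : X) : cstr (cs m) := inc (cs m) (tagged x : cstr (cs (tag x))).
pose L (x y : X) := sle (at_ (maxn (tag x) (tag y)) x) (at_ (maxn (tag x) (tag y)) y).
have at_inc m n (x : X) : (tag x <= m)%N -> (m <= n)%N -> inc (cs n) (at_ m x) = at_ n x.
  exact: chain_inc.
have at_id (x : X) : at_ (tag x) x = tagged x.
  by apply: cval_inj; rewrite cval_inc.
(* Transition maps are embeddings, so two points may be compared at any stage that contains both. *)
have LE m x y : (tag x <= m)%N -> (tag y <= m)%N -> L x y <-> sle (at_ m x) (at_ m y).
  move=> xm ym; have xym : (maxn (tag x) (tag y) <= m)%N by rewrite geq_max xm ym.
  have [_ [_ i_le _]] := chain_code_le xym.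
  by rewrite /L -i_le !at_inc ?leq_maxl ?leq_maxr.
pose op g (x : X) : X := Tagged (fun k => seg (csize (cs k))) (sop g (tagged x : cstr (cs (tag x)))).
have at_op m g (x : X) : (tag x <= m)%N -> at_ m (op g x) = sop g (at_ m x).
  by move=> xm; have [_ [_ _ i_op]] := chain_code_le xm; apply: i_op.
have Lpre : preorder L.
  split=> [x|x y z]; first by have [r _ _] := cs_po (maxn (tag x) (tag x)); apply: r.
  pose m := maxn (tag x) (maxn (tag y) (tag z)).
  have xm : (tag x <= m)%N by rewrite leq_maxl.
  have ym : (tag y <= m)%N by rewrite /m maxnCA leq_maxl.
  have zm : (tag z <= m)%N by rewrite /m maxnC -maxnA maxnCA leq_maxl.
  by rewrite !(LE m) //; have [_ _ t] := cs_po m; apply: t.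
have Lop g x y : L x y -> L y x -> L (op g x) (op g y).
  pose m := maxn (tag x) (tag y).
  have [xm ym] : (tag x <= m)%N /\ (tag y <= m)%N by rewrite leq_maxl leq_maxr.
  rewrite !(LE m) // => xy yx; rewrite !at_op //; have [r a _] := cs_po m.
  by rewrite (a _ _ xy yx); apply: r.
have inhX : inhabited X by exists; exists 0; exact: (seg_of _ 0).
have [M [pi [pi_surj pi_le pi_op Mpo]]] := preorder_quotient inhX Lpre Lop.
pose iota k (y : cstr (cs k)) : M := pi (Tagged (fun k => seg (csize (cs k))) y).
exists M, iota; split.
- have [rep repP] := choice pi_surj; apply/countable_injP.
  exists (fun x => choice.pickle (tag (rep x), sval (tagged (rep x)))) => x y _ _.
  move=> /(pcan_inj choice.pickleK) xy; rewrite -(repP x) -(repP y).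
  case: (rep x) (rep y) xy => [k a] [l b] /= [kl]; case: l / kl b => b ab.
  by congr (pi (existT _ _ _)); apply: val_inj.
- move=> k; apply: embedding_poset => // [x y|g x]; last by rewrite /iota -pi_op.
  by rewrite /iota pi_le (LE k) // (at_id (existT _ k x)) (at_id (existT _ k y)).
- by move=> x; have [[k y] <-] := pi_surj x; exists k, y.
- move=> k l y kl; have [r a _] := Mpo; have [r' _ _] := cs_po l.
  have [? _] := chain_code_le kl.
  by apply: a; apply/pi_le/(LE l) => //=; rewrite /at_ /= !chain_inc //; apply: r'.
Qed.

End Limit.
End Codes.

(** * Fraisse limits *)

(** Ultrahomogeneity in terms of graphs: no substructure types occur, and the graph can be written
    down directly from two tuples. *)
Definition homogeneous (F : Type) (M : structure F) : Prop :=
  forall R : M -> M -> Prop, piso R -> finite_set [set x | exists y, R x y] ->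
    exists s : M -> M, isomorphism s /\ forall x y, R x y -> s x = y.

Section Fraisse.
Variables (F : finType) (K : set (structure F)).
Hypotheses (Kher : hereditary K) (Kloc : locally_determined K)
  (Kpo : forall A, K A -> partial_order A) (Kam : amalgamation K).

(** A task asks for an embedding of [t.1] whose values on some points are prescribed by the numbers
    in [t.2]. It mentions no stage, so all tasks together form a countable type. *)
Definition task_rel (t : code F * seq (nat * nat)) (c : code F)
    (b : cstr t.1) (x : cstr c) : Prop := (cval b, cval x) \in t.2.

Lemma task_step (c : code F) (t : code F * seq (nat * nat)) : K (cstr c) ->
  exists c' : code F, [/\ K (cstr c'), code_le c c' &
    K (cstr t.1) -> piso (@task_rel t c) ->
    exists e : cstr t.1 -> cstr c', embedding e /\
      forall b (x : cstr c), @task_rel t c b x -> e b = inc c' x].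
Proof.
move=> Kc; have [[Kt Rt]|no] := EM (K (cstr t.1) /\ piso (@task_rel t c)); last first.
  exists c; split=> //; first exact: code_le_refl.
  by move=> Kt Rt; case: no.
have [D [u [v [[KD Dfin] eu ev uv]]]] :=
  Kam (conj Kt (cstr_finite _)) (conj Kc (cstr_finite _)) Rt.
(* The amalgam is numbered so that the points coming from [c] keep their numbers. *)
have [c' [j [ij cc' jv]]] : exists (c' : code F) (j : D -> cstr c'),
    [/\ isomorphism j, (csize c <= csize c')%N &
        forall i, (i < (csize c).+1)%N -> cval (j (v (seg_of (csize c) i))) = i].
  apply: code_extend => // i k ic kc E; have [v_inj _ _] := ev.
  by rewrite -(seg_ofK ic) (v_inj _ _ E) seg_ofK.
have [k [ek kj]] := isomorphism_inv ij.
have jvE x : j (v x) = inc c' x.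
  apply: cval_inj; rewrite cval_inc // -[RHS](jv _ (cval_lt x)); congr (cval (j (v _))).
  by apply: cval_inj; rewrite [RHS]seg_ofK // cval_lt.
exists c'; split=> [||_ _]; first exact: (Kher ek).
  split=> //; suff -> : @inc F c c' = j \o v by apply: embedding_comp ij.1.
  by apply/funext => x /=; rewrite jvE.
exists (j \o u); split=> [|b x bx]; first exact: embedding_comp ij.1.
by rewrite /= (uv _ _ bx) jvE.
Qed.

(** The pairs [(t, i)] have distinct codes, and [k0 + 1] of them cannot all be below [k0]. Every
    task is thus met at arbitrarily late stages. *)
Lemma pickle_unbounded (T : countType) (t : T) k0 :
  exists k (i : nat), (k0 <= k)%N /\ choice.unpickle k = Some (t, i).
Proof.
apply: contrapT => no.
pose s := [seq choice.pickle (t, i) | i <- iota 0 k0.+1].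
have s_uniq : uniq s.
  by rewrite map_inj_uniq ?iota_uniq // => i j /(pcan_inj choice.pickleK)[].
have /(uniq_leq_size s_uniq) : {subset s <= iota 0 k0}.
  move=> _ /mapP[i _ ->]; rewrite mem_iota /= ltnNge; apply/negP => le.
  by apply: no; exists (choice.pickle (t, i)), i; rewrite choice.pickleK.
by rewrite size_map !size_iota ltnn.
Qed.

Lemma generic_chain : (exists A, finite_members K A) ->
  exists cs : nat -> code F,
    [/\ forall k, K (cstr (cs k)), forall k, code_le (cs k) (cs k.+1) &
        forall (t : code F * seq (nat * nat)) k0, K (cstr t.1) ->
        exists k, (k0 <= k)%N /\ (piso (@task_rel t (cs k)) ->
          exists e : cstr t.1 -> cstr (cs k.+1), embedding e /\
            forall b (x : cstr (cs k)), @task_rel t _ b x -> e b = inc (cs k.+1) x)].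
Proof.
move=> [A [KA Afin]]; have [a] := carrier_inhabited A.
have [|c0 [j [ij _ _]]] := code_extend (n := 0) (e := fun=> a) Afin.
  by move=> [|i] [|k].
have Kc0 : K (cstr c0) by have [k [/Kher + _]] := isomorphism_inv ij; apply.
have stepP (s : {c : code F | K (cstr c)} * (code F * seq (nat * nat))) :
    exists s' : {c : code F | K (cstr c)}, code_le (sval s.1) (sval s') /\
    (K (cstr s.2.1) -> piso (@task_rel s.2 (sval s.1)) ->
    exists e : cstr s.2.1 -> cstr (sval s'), embedding e /\
      forall b (x : cstr (sval s.1)), @task_rel s.2 _ b x -> e b = inc (sval s') x).
  case: s => [[c Kc] t]; have [c' [Kc' cc' H]] := task_step t Kc.
  by exists (exist _ c' Kc').
have [next nextP] := choice stepP.
(* A number that decodes to no task gets one without prescribed values. *)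
pose tsk k : code F * seq (nat * nat) :=
  if (choice.unpickle k : option ((code F * seq (nat * nat)) * nat)) is Some (t, _)
  then t else (c0, [::]).
pose st := fix st n := if n is k.+1 then next (st k, tsk k)
  else exist (fun c => K (cstr c)) c0 Kc0.
exists (fun k => sval (st k)); split=> [k|k|t k0 Kt].
- exact: svalP (st k).
- by have [] := nextP (st k, tsk k).
have [k [i [k0k ki]]] := @pickle_unbounded (code F * seq (nat * nat))%type t k0.
exists k; split=> //; have [_] := nextP (st k, tsk k).
by rewrite /= /tsk ki; apply.
Qed.

Lemma fraisse : (exists A, finite_members K A) ->
  exists M : structure F,
    [/\ fraisse_limit (finite_members K) M, K M & homogeneous M].
Proof.
move=> /generic_chain[cs [Kcs cs_le csP]].
have [M [iota [Mcnt iotaE iota_surj iota_inc]]] := direct_limit cs_le (fun k => Kpo (Kcs k)).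
pose stage k x := exists y, iota k y = x.
have stage_mono k l x : (k <= l)%N -> stage k x -> stage l x.
  by move=> kl [y <-]; exists (inc (cs l) y); apply: iota_inc.
have stages (s : seq M) : exists k, forall x, List.In x s -> stage k x.
  elim: s => [|x s [k IH]]; first by exists 0.
  have [l [y yx]] := iota_surj x; exists (maxn k l) => z /= [<-|/IH].
    by apply: (stage_mono l); [rewrite leq_maxr|exists y].
  by apply: stage_mono; rewrite leq_maxl.
have stage_fin k : finite_set (stage k).
  have /finite_setE_In[s sP] := cstr_finite (cs k).
  apply/finite_setE_In; exists (List.map (iota k) s) => _ [y <-].
  exact/List.in_map/sP.
have KM : K M.
  apply: Kloc => x y z; have [k kP] := stages [:: x; y; z].
  have [[a ax] [[b bx] [c cx]]] : stage k x /\ stage k y /\ stage k z.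
    by split; [|split]; apply: kP => /=; tauto.
  by exists (cstr (cs k)), (iota k); split=> //; exists a, b, c.
have Mpo := Kpo KM.
(* The extension property of the limit, from which both homogeneity and universality follow. *)
have extend (c : code F) (R : cstr c -> M -> Prop) k : K (cstr c) -> piso R ->
    (forall b x, R b x -> stage k x) ->
    exists e : cstr c -> M, embedding e /\ forall b x, R b x -> e b = x.
  move=> Kc [Rle Rop] Rk.
  (* [R] listed by the numbers at stage [k]. Numbers are kept along the chain, so [r] describes [R]
     also at the later stage [l] where the task is taken up. *)
  pose r := [seq p <- allpairs pair (seq.iota 0 (csize c).+1) (seq.iota 0 (csize (cs k)).+1) |
    `[< exists b (x : cstr (cs k)), [/\ cval b = p.1, cval x = p.2 & R b (iota k x)] >]].
  have [l [kl +]] := csP (c, r) k Kc; rewrite /=.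
  have iota_inj : injective (iota l) by case: (iotaE l).
  have [klz _] := chain_code_le cs_le kl.
  have rE b (x : cstr (cs l)) : task_rel (t := (c, r)) b x <-> R b (iota l x).
    rewrite /task_rel mem_filter; split.
      move=> /andP[/asboolP[b' [x' [/= /cval_inj -> xx' Rbx]]] _].
      have <- : inc (cs l) x' = x by apply: cval_inj; rewrite cval_inc.
      by rewrite iota_inc.
    move=> Rbx; have [x' xx'] := Rk _ _ Rbx.
    have xE : x = inc (cs l) x' by apply: iota_inj; rewrite iota_inc.
    have xv : cval x = cval x' by rewrite xE cval_inc.
    apply/andP; split; first by apply/asboolP; exists b, x'; rewrite /= xv xx'.
    by rewrite allpairs_f // mem_iota /= add0n ?xv cval_lt.
  case=> [|e [ee eP]].
    have [_ i_le i_op] := iotaE l; split=> [b b' x x' /rE bx /rE bx'|g b x /rE bx].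
      by rewrite (Rle _ _ _ _ bx bx') i_le.
    by apply/rE; rewrite i_op; apply: Rop.
  exists (iota l.+1 \o e); split=> [|b x bx]; first exact: embedding_comp.
  have [y yx] := stage_mono _ _ _ kl (Rk _ _ bx).
  by rewrite /= (eP b y) ?iota_inc //; apply/rE; rewrite yx.
(* Confining domain and range to one stage carries finiteness through the back-and-forth. *)
pose P (R : M -> M -> Prop) := piso R /\ exists k, forall x y, R x y -> stage k x /\ stage k y.
have forth R : P R -> forall a, exists R', [/\ P R', forall x y, R x y -> R' x y & exists b, R' a b].
  move=> [[Rle Rop] [k Rk]] a; have [l [y ya]] := iota_surj a.
  (* Stage [m] contains the domain of [R] and the point [a]; an embedding of the whole stage over
     [R] is the extension sought. *)
  pose m := maxn k l; have [_ i_le i_op] := iotaE m.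
  have [|||e [ee eP]] := extend (cs m) (fun b x => R (iota m b) x) k.
  - exact: Kcs.
  - split=> [b b' x x' bx bx'|g b x bx]; last by rewrite i_op; apply: Rop.
    by rewrite -i_le; apply: Rle.
  - by move=> b x /Rk[].
  have [_ e_le e_op] := ee.
  exists (fun x y => exists b, iota m b = x /\ e b = y); split.
  - split; first split=> [_ _ _ _ [b [<- <-]] [b' [<- <-]]|g _ _ [b [<- <-]]].
    + by rewrite i_le e_le.
    + by exists (sop g b); rewrite i_op e_op.
    have /finite_setE_In[s sP] := cstr_finite (cs m).
    have [n nP] := stages (List.map e s); exists (maxn m n) => _ _ [b [<- <-]]; split.
      by apply: (stage_mono m); [rewrite leq_maxl|exists b].
    by apply: (stage_mono n); [rewrite leq_maxr|apply/nP/List.in_map/sP].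
  - move=> x z xz; have [+ _] := Rk _ _ xz => /(stage_mono _ m)[|b bx]; first by rewrite leq_maxl.
    by exists b; split=> //; apply: eP; rewrite bx.
  - have [b ba] : stage m a by apply: (stage_mono l); [rewrite leq_maxr|exists y].
    by exists (e b), b.
have Pinv R : P R -> P (fun x y => R y x).
  by move=> [/piso_inv Ri [k Rk]]; split=> //; exists k => x y /Rk[].
have hom : homogeneous M.
  move=> R Riso Rfin; apply: (back_and_forth (P := P)) => //.
  - move=> {Riso Rfin}R [Ri _] a a' b b' ab ab'; split; first exact: Ri.1.
    + split=> E; first by rewrite E in ab; apply: piso_fun Ri ab ab'.
      by rewrite E in ab; apply: (piso_fun Mpo (piso_inv Ri)) ab ab'.
    + by move=> g ga; apply: (piso_fun Mpo Ri _ ab'); rewrite -ga; apply: Ri.2.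
  - move=> {Riso Rfin}R /Pinv/forth fR b; have [R' [/Pinv PR' RR' [a ab]]] := fR b.
    by exists (fun x y => R' y x); split=> // [x y|]; [apply: RR'|exists a].
  split=> //; have /finite_setE_In[s sP] := Rfin.
  have [t tP] : exists t, forall x y, List.In x s -> R x y -> List.In y t.
    elim: {sP}s => [|x s [t IH]]; first by exists [::].
    have [[y xy]|no] := EM (exists y, R x y); last first.
      by exists t => x' y /= [<- xy|]; [case: no; exists y|apply: IH].
    exists (y :: t) => x' y' /= [<- xy'|xs xy']; last by right; apply: IH xy'.
    by left; apply: piso_fun Riso xy xy'.
  have [k kP] := stages (s ++ t); exists k => x y xy.
  have xs : List.In x s by apply: sP; exists y.
  by split; apply/kP/List.in_app_iff; [left|right; apply: tP xy].
(* Stages are closed under the operations, so one that contains the generators contains the whole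
   image; hence the age has finite members only. *)
have fg_stage (A : structure F) (h : A -> M) : embedding h -> finitely_generated A ->
    exists k, forall a, stage k (h a).
  move=> [_ _ h_op] [X [/finite_setE_In[s sX] Xgen]].
  have [k kP] := stages (List.map h s); exists k => a.
  have : generated X a by rewrite Xgen.
  move=> /(_ (fun a => stage k (h a))); apply.
    move=> g x [y yx]; exists (sop g y); have [_ _ ->] := iotaE k.
    by rewrite yx h_op.
  by move=> x /sX xs; apply/kP/List.in_map.
have sub_emb (S : subuniverse M) : embedding (fun x : substructure S => sval x : M).
  by split=> // x y; apply: eq_sig_hprop => z p q; apply: Prop_irrelevance.
exists M; split=> //; split=> //.
- move=> S S' Sfg _ h [[h_inj h_le h_op] h_surj].
  pose R x y := exists z : substructure S, x = sval z /\ y = sval (h z).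
  have [||s [is_ sR]] := hom R.
  + split=> [_ _ _ _ [z [-> ->]] [z' [-> ->]]|g _ _ [z [-> ->]]].
      exact: iff_sym (h_le z z').
    by exists (sop g z); rewrite h_op.
  + have [k kP] := fg_stage _ _ (sub_emb S) Sfg.
    by apply: sub_finite_set (stage_fin k) => _ [_ [z [-> _]]]; apply: kP.
  by exists s; split=> // x; apply: sR; exists x.
- move=> A; split=> [[Afg [h eh]]|[KA Afin]].
    split; first exact: (Kher eh).
    have [k kP] := fg_stage _ _ eh Afg; have [h_inj _ _] := eh.
    have -> : [set: A] = h @^-1` (stage k) by apply/seteqP; split=> // a _; apply: kP.
    by apply: finite_preimage => // x y _ _ /h_inj.
  split.
    exists [set: A]; split=> //; apply/seteqP; split=> // x _ S _ +.
    by apply.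
  have [a] := carrier_inhabited A.
  have [|c [j [ij _ _]]] := code_extend (n := 0) (e := fun=> a) Afin.
    by move=> [|i] [|k].
  have Kc : K (cstr c) by have [k [/Kher + _]] := isomorphism_inv ij; apply.
  (* With nothing prescribed, the extension property gives universality. *)
  have [//|//|e [ee _]] := extend c (fun _ _ => False) 0 Kc.
  by exists (e \o j); apply: embedding_comp ee; case: ij.
Qed.

End Fraisse.

(** * Quantifier elimination and omega-categoricity *)

Section Connectives.
Variable F : Type.
Implicit Types (A : structure F) (p q : formula F).

Definition fnot p := Imp p Bot.
Definition fand p q := fnot (Imp p (fnot q)).

Lemma sat_fand A (v : nat -> A) p q : sat v (fand p q) <-> sat v p /\ sat v q.
Proof.
split=> [H|[Hp Hq] /=]; last by apply.
by split; apply: contrapT => no; apply: H => /= vp // vq.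
Qed.

Variables (V : seq nat) (L : seq (formula F)).
Hypothesis L_qf : forall p, List.In p L -> quantifier_free p /\ {subset free_vars p <= V}.

(** Case distinction on the truth of the first formula of the list: in each case what remains is
    determined by the other formulas. *)
Lemma separate_by A (P : (nat -> A) -> Prop) :
  (forall v w, (forall p, List.In p L -> sat v p <-> sat w p) -> P v -> P w) ->
  exists q, [/\ quantifier_free q, {subset free_vars q <= V} & forall v, P v <-> sat v q].
Proof.
elim: L L_qf P => [|r s IHs] qfL P PL /=.
  have [[v Pv]|no] := EM (exists v, P v).
    by exists (fnot Bot); split=> // w; split=> _; [move=> []|apply: (PL v)].
  by exists Bot; split=> // w; split=> // Pw; case: no; exists w.
have {}IHs := IHs (fun p ps => qfL p (or_intror ps)).
(* The branch of [P] where [r] has truth value [b]; the witness [w], which agrees with [v] on [s],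
   removes the dependence on [r] at [v]. *)
pose Q (b : Prop) (v : nat -> A) := exists w : nat -> A, [/\ forall p, List.In p s -> sat w p <-> sat v p, sat w r <-> b & P w].
have QL b v w : (forall p, List.In p s -> sat v p <-> sat w p) -> Q b v -> Q b w.
  by move=> vw [u [uv ub Pu]]; exists u; split=> // p ps; rewrite uv ?vw.
have [[q1 [qf1 fv1 q1P]] [q0 [qf0 fv0 q0P]]] := (IHs _ (QL True), IHs _ (QL False)).
have [qfr fvr] := qfL r (or_introl erefl).
exists (fand (Imp r q1) (Imp (fnot r) q0)); split=> [|k|v].
- by rewrite /= qfr qf1 qf0.
- by rewrite /= !cats0 !mem_cat => /orP[/orP[/fvr|/fv1]|/orP[/fvr|/fv0]].
rewrite sat_fand /= -q1P -q0P; split=> [Pv|[H1 H0]].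
  by split=> vr; exists v; split.
have [vr|vr] := EM (sat v r).
- have [w [wv wr Pw]] := H1 vr; by apply: (PL w) => // p [<-|]; [tauto|apply: wv].
- have [w [wv wr Pw]] := H0 vr; by apply: (PL w) => // p [<-|]; [tauto|apply: wv].
Qed.

(** [D] is the conjunction of the formulas of [L] true at [v] and of the negations of the others. *)
Lemma diagram_formula A (v : nat -> A) : exists D : formula F,
  [/\ {subset free_vars D <= V}, sat v D &
      forall (B : structure F) (w : nat -> B), sat w D ->
        forall p, List.In p L -> sat v p <-> sat w p].
Proof.
elim: L L_qf => [|r s IHs] qfL /=; first by exists (fnot Bot); split=> // [].
have [D [fvD vD DP]] := IHs (fun p ps => qfL p (or_intror ps)).
have [_ fvr] := qfL r (or_introl erefl).
have [vr|vr] := EM (sat v r).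
- exists (fand r D); split=> [k||B w /sat_fand[wr wD] p [<-|]].
  + by rewrite /= !cats0 mem_cat => /orP[/fvr|/fvD].
  + exact/sat_fand.
  + by split.
  + exact: DP.
- exists (fand (fnot r) D); split=> [k||B w /sat_fand[wr wD] p [<-|]].
  + by rewrite /= !cats0 mem_cat => /orP[/fvr|/fvD].
  + exact/sat_fand.
  + by split=> [/vr|/wr].
  + exact: DP.
Qed.

End Connectives.

(** * First-order axioms inherited by the models of a theory *)

Lemma theory_of_partial_order (F : Type) (K : set (structure F)) A :
  (forall B, K B -> partial_order B) -> models (theory_of K) A -> partial_order A.
Proof.
move=> Kpo TA; split.
- move=> x; apply: (theory_of_holds TA (p := Le (Var 0) (Var 0)) _ (fun=> x)).
  by move=> B /Kpo[Br _ _] v; apply: Br.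
- move=> x y.
  apply: (theory_of_holds TA (p := Imp (Le (Var 0) (Var 1)) (Imp (Le (Var 1) (Var 0))
    (Eq (Var 0) (Var 1)))) _ (fun n => if n is 0 then x else y)).
  by move=> B /Kpo[_ Ba _] v; apply: Ba.
- move=> x y z.
  apply: (theory_of_holds TA (p := Imp (Le (Var 0) (Var 1)) (Imp (Le (Var 1) (Var 2))
    (Le (Var 0) (Var 2)))) _ (fun n => match n with 0 => x | 1 => y | _ => z end)).
  by move=> B /Kpo[_ _ Bt] v; apply: Bt.
Qed.

Lemma theory_of_linear_order (F : Type) (K : set (structure F)) A :
  (forall B, K B -> linear_order B) -> models (theory_of K) A -> linear_order A.
Proof.
move=> Klin TA; split; first by apply: (theory_of_partial_order _ TA) => B /Klin[].
move=> x y; have [xy|xy] := EM (sle x y); [by left|right].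
apply: (theory_of_holds TA (p := Imp (fnot (Le (Var 0) (Var 1))) (Le (Var 1) (Var 0)))
  _ (fun n => if n is 0 then x else y)) => //.
by move=> B /Klin[_ Btot] v /= no; case: (Btot (v 0) (v 1)) => // /no.
Qed.

Lemma theory_of_order_preserving (F : Type) (K : set (structure F)) A g :
  (forall B, K B -> order_preserving B g) -> models (theory_of K) A ->
  order_preserving A g.
Proof.
move=> Kg TA x y.
apply: (theory_of_holds TA (p := Imp (Le (Var 0) (Var 1)) (Le (App g (Var 0)) (App g (Var 1))))
  _ (fun n => if n is 0 then x else y)).
by move=> B /Kg Bg v; apply: Bg.
Qed.

Lemma theory_of_order_reversing (F : Type) (K : set (structure F)) A g :
  (forall B, K B -> order_reversing B g) -> models (theory_of K) A ->
  order_reversing A g.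
Proof.
move=> Kg TA x y.
apply: (theory_of_holds TA (p := Imp (Le (Var 0) (Var 1)) (Le (App g (Var 1)) (App g (Var 0))))
  _ (fun n => if n is 0 then x else y)).
by move=> B /Kg Bg v; apply: Bg.
Qed.

(** * Types of tuples under one unary operation *)

Definition tm (k i : nat) : term unit := iter k (App tt) (Var i).

Lemma eval_tm (A : structure unit) (v : nat -> A) k i :
  eval v (tm k i) = iter k (sop tt) (v i).
Proof. by elim: k => //= k ->. Qed.

Lemma tvar_tm k i : tvar (tm k i) = i.
Proof. by elim: k. Qed.

Lemma termE (t : term unit) : exists k, t = tm k (tvar t).
Proof. by elim: t => [n|[] t [k tE]] /=; [exists 0|exists k.+1; rewrite {1}tE]. Qed.

(** Order atoms are enough, because antisymmetry turns an equality into two of them. *)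
Definition same_type (V : seq nat) (A B : structure unit) (v : nat -> A) (w : nat -> B) : Prop :=
  forall i j, i \in V -> j \in V -> forall k l,
    sle (iter k (sop tt) (v i)) (iter l (sop tt) (v j)) <->
    sle (iter k (sop tt) (w i)) (iter l (sop tt) (w j)).

Lemma same_type_eq V (A B : structure unit) (v : nat -> A) (w : nat -> B) i j k l :
  partial_order A -> partial_order B -> same_type V v w -> i \in V -> j \in V ->
  iter k (sop tt) (v i) = iter l (sop tt) (v j) <->
  iter k (sop tt) (w i) = iter l (sop tt) (w j).
Proof.
move=> [Ar Aa _] [Br Ba _] vw iV jV; split=> E.
- by apply: Ba; apply/vw => //; rewrite E; apply: Ar.
- by apply: Aa; apply/(vw _ _ _ _) => //; rewrite E; apply: Br.
Qed.

Lemma same_type_qf V (A B : structure unit) (v : nat -> A) (w : nat -> B) p :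
  partial_order A -> partial_order B -> same_type V v w ->
  quantifier_free p -> {subset free_vars p <= V} -> sat v p <-> sat w p.
Proof.
move=> Apo Bpo vw; elim: p => [|t u|t u|p IHp q IHq|n p IHp] //=.
- have [[k ->] [l ->]] := (termE t, termE u); rewrite !tvar_tm => _ pV.
  by rewrite !eval_tm; apply: same_type_eq vw _ _ => //; apply: pV; rewrite !inE eqxx ?orbT.
- have [[k ->] [l ->]] := (termE t, termE u); rewrite !tvar_tm => _ pV.
  by rewrite !eval_tm; apply: vw; apply: pV; rewrite !inE eqxx ?orbT.
- move=> /andP[qfp qfq] pV; rewrite IHp ?IHq // => k kp; apply: pV;
    by rewrite mem_cat kp ?orbT.
Qed.

(** The exponent [m.+2] wraps around to [m]. [k'] is chosen before the structure, so that one finite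
    list of terms serves all models. *)
Lemma iter_reduce m k : exists k', (k' < m.+2)%N /\
  forall A : structure unit, iterate_condition m A ->
    forall x : A, iter k (sop tt) x = iter k' (sop tt) x.
Proof.
elim: k => [|k [k' [lt IHk]]]; first by exists 0.
have [lt'|ge] := ltnP k'.+1 m.+2; first by exists k'.+1; split=> // A Am x /=; rewrite (IHk A).
exists m; split=> [|A Am x]; first by rewrite ltnS leqnSn.
have k'E : k' = m.+1 by apply/eqP; rewrite eqn_leq -ltnS lt.
by rewrite /= (IHk A) // k'E; apply: Am.
Qed.

Definition type_atoms (m : nat) (V : seq nat) : seq (formula unit) :=
  let ts := List.map (fun x => tm x.1 x.2) (List.list_prod (iota 0 m.+2) V) in
  List.map (fun x => Le x.1 x.2) (List.list_prod ts ts).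

Lemma type_atoms_qf m V p : List.In p (type_atoms m V) ->
  quantifier_free p /\ {subset free_vars p <= V}.
Proof.
move=> /List.in_map_iff[[t u] [<- /List.in_prod_iff[]]].
move=> /List.in_map_iff[[k i] [<- /List.in_prod_iff[_ /InP iV]]].
move=> /List.in_map_iff[[l j] [<- /List.in_prod_iff[_ /InP jV]]].
by split=> // n; rewrite /= !tvar_tm !inE => /orP[]/eqP->.
Qed.

Lemma same_type_atoms m V (A B : structure unit) (v : nat -> A) (w : nat -> B) :
  iterate_condition m A -> iterate_condition m B ->
  (forall p, List.In p (type_atoms m V) -> sat v p <-> sat w p) -> same_type V v w.
Proof.
move=> Am Bm vw i j iV jV k l.
have [[k' [kk' kE]] [l' [ll' lE]]] := (iter_reduce m k, iter_reduce m l).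
rewrite !(kE A Am) !(kE B Bm) !(lE A Am) !(lE B Bm) -!eval_tm.
apply: (vw (Le (tm k' i) (tm l' j))); apply/List.in_map_iff.
exists (tm k' i, tm l' j); split=> //.
by apply: List.in_prod; apply/List.in_map_iff; [exists (k', i)|exists (l', j)];
  split=> //; apply: List.in_prod; apply/InP => //; rewrite mem_iota.
Qed.

Section Homogeneous.
Variables (m : nat) (M : structure unit).
Hypotheses (Mpo : partial_order M) (Mm : iterate_condition m M) (Mhom : homogeneous M).

(** Matching the iterates of the two tuples gives a partial isomorphism with finite domain; an
    automorphism extending it carries [v] to [w] on the free variables. *)
Lemma homogeneous_same_type (v w : nat -> M) p :
  same_type (free_vars p) v w -> sat v p -> sat w p.
Proof.
move=> vw; pose V := free_vars p.
pose R x y := exists j k, [/\ j \in V, x = iter k (sop tt) (v j) & y = iter k (sop tt) (w j)].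
have [||s [is_ sR]] := Mhom (R := R).
- split=> [_ _ _ _ [i [k [iV -> ->]]] [j [l [jV -> ->]]]|[] _ _ [j [k [jV -> ->]]]].
    exact: vw.
  by exists j, k.+1.
- apply/finite_setE_In; exists (List.map (fun x => iter x.1 (sop tt) (v x.2)) (List.list_prod (iota 0 m.+2) V)).
  move=> _ [_ [j [k [jV -> _]]]]; have [k' [kk' kE]] := iter_reduce m k.
  rewrite (kE M Mm); apply/List.in_map_iff; exists (k', j); split=> //.
  by apply: List.in_prod; apply/InP => //; rewrite mem_iota.
move=> /(sat_isomorphism _ _ is_) vp.
by apply/(sat_free_vars (w := s \o v)) => // j jV /=; apply/esym/sR; exists j, 0.
Qed.

Lemma homogeneous_qe : quantifier_elimination (Th M).
Proof.
move=> p; have qfL := @type_atoms_qf m (free_vars p).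
have [|q [qfq fvq qP]] := separate_by qfL (A := M) (P := fun v => sat v p).
  by move=> v w vw; apply: homogeneous_same_type; apply: (same_type_atoms Mm Mm).
exists q; split=> // A TA v.
have /(Th_holds TA)/(_ v)/sat_fand[] : holds M (fand (Imp p q) (Imp q p)).
  by move=> w; apply/sat_fand; split=> /qP.
by [].
Qed.

Lemma Th_partial_order A : models (Th M) A -> partial_order A.
Proof. by apply: theory_of_partial_order => _ ->. Qed.

Lemma Th_iterate_condition A : models (Th M) A -> iterate_condition m A.
Proof.
move=> TA x; have /(Th_holds TA)/(_ (fun=> x)) : holds M (Eq (tm m.+2 0) (tm m 0)).
  by move=> v /=; rewrite eval_tm; apply: Mm.
by rewrite /= eval_tm.
Qed.

(** [A] and [B] need not be homogeneous. That some point realises the type of [a] over the tuple is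
    expressed by [p], a formula in the first [n] variables; its quantifier-free equivalent passes
    from [v] to [w]. *)
Lemma same_type_extend (A B : structure unit) n (v : nat -> A) (w : nat -> B) a :
  models (Th M) A -> models (Th M) B -> same_type (iota 0 n) v w ->
  exists b, same_type (iota 0 n.+1) (update v n a) (update w n b).
Proof.
move=> TA TB vw.
have qfL := @type_atoms_qf m (iota 0 n.+1).
have [D [fvD vD DP]] := diagram_formula qfL (update v n a).
pose p := fnot (All n (fnot D)).
have [q [qfq fvq qP]] := homogeneous_qe p.
have fvp : {subset free_vars p <= iota 0 n}.
  move=> k; rewrite /= cats0 mem_filter cats0 => /andP[kn /fvD].
  by rewrite !mem_iota /= !add0n ltnS leq_eqVlt (negPf kn).
have vp : sat v p by move=> /(_ a)/(_ vD).
have /(qP B TB w) wp : sat w q.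
  apply/(same_type_qf (Th_partial_order TA) (Th_partial_order TB) vw qfq); last exact/(qP A TA v).
  by move=> k /fvq/fvp.
have [b wD] : exists b, sat (update w n b) D.
  by apply: contrapT => no; apply: wp => b wD; apply: no; exists b.
exists b; apply: (@same_type_atoms m); [exact: Th_iterate_condition|exact: Th_iterate_condition|].
exact: DP wD.
Qed.

Lemma homogeneous_omega_categorical : countable [set: M] -> omega_categorical (Th M).
Proof.
move=> Mcnt; split; first by exists M; split=> // p [_]; apply.
move=> A B TA TB Acnt Bcnt.
have [Apo Bpo] := (Th_partial_order TA, Th_partial_order TB).
pose P (R : A -> B -> Prop) := exists n v w, same_type (iota 0 n) v w /\
  forall x y, R x y <-> exists i, [/\ (i < n)%N, x = v i & y = w i].
have same_sym (A' B' : structure unit) V (v : nat -> A') (w : nat -> B') :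
    same_type V v w -> same_type V w v.
  by move=> vw i j iV jV k l; apply: iff_sym; apply: vw.
have ext (A' B' : structure unit) n (v : nat -> A') (w : nat -> B') a :
    models (Th M) A' -> models (Th M) B' -> same_type (iota 0 n) v w ->
    exists (v' : nat -> A') (w' : nat -> B'), [/\ same_type (iota 0 n.+1) v' w',
      forall i, (i < n)%N -> v' i = v i /\ w' i = w i & v' n = a].
  move=> TA' TB' vw; have [b vw'] := same_type_extend a TA' TB' vw.
  exists (update v n a), (update w n b); split=> // [i lt|]; rewrite /update ?eqxx //.
  by rewrite !ltn_eqF.
have [a0 b0] : inhabited A /\ inhabited B by split; apply: carrier_inhabited.
case: a0 b0 => a0 [b0].
have [||||h [ih _]] := back_and_forth (P := P) (R0 := fun _ _ => False) Acnt Bcnt; last by exists h.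
- move=> R [n [v [w [vw RE]]]] _ _ _ _ /RE[i [lti -> ->]] /RE[j [ltj -> ->]].
  have [iV jV] : i \in iota 0 n /\ j \in iota 0 n by rewrite !mem_iota.
  split=> [||[] E].
  + exact: (vw i j iV jV 0 0).
  + exact: (same_type_eq 0 0 Apo Bpo vw iV jV).
  + exact/(same_type_eq 1 0 Apo Bpo vw iV jV).
- move=> R [n [v [w [vw RE]]]] a; have [v' [w' [vw' old v'n]]] := ext _ _ _ _ _ a TA TB vw.
  exists (fun x y => exists i, [/\ (i < n.+1)%N, x = v' i & y = w' i]); split.
  + by exists n.+1, v', w'.
  + by move=> x y /RE[i [lt -> ->]]; have [<- <-] := old _ lt; exists i; rewrite ltnW.
  + by exists (w' n), n.
- move=> R [n [v [w [/same_sym vw RE]]]] b.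
  have [w' [v' [/same_sym vw' old v'n]]] := ext _ _ _ _ _ b TB TA vw.
  exists (fun x y => exists i, [/\ (i < n.+1)%N, x = v' i & y = w' i]); split.
  + by exists n.+1, v', w'.
  + by move=> x y /RE[i [lt -> ->]]; have [<- <-] := old _ lt; exists i; rewrite ltnW.
  + by exists (v' n), n.
- by exists 0, (fun=> a0), (fun=> b0); split=> [i j //|x y]; split=> // -[i []].
Qed.

End Homogeneous.

(** * Ultrapowers and the model completion *)

Lemma ultrapower (F : Type) (M : structure F) (I : Type) (U : set_system I) :
  partial_order M -> UltraFilter U ->
  exists (B : structure F) (pi : (I -> M) -> B),
    [/\ models (Th M) B, partial_order B,
        forall x y, sle (pi x) (pi y) <-> U [set i | sle (x i) (y i)]
      & forall g x, pi (fun i => sop g (x i)) = sop g (pi x)].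
Proof.
move=> Mpo UU; have [Mr Ma Mt] := Mpo.
have UT (P : set I) : (forall i, P i) -> U P.
  by move=> PT; apply: filterS filterT => i _.
pose L (x y : I -> M) := U [set i | sle (x i) (y i)].
have US2 (P Q S : set I) : U P -> U Q -> (forall i, P i -> Q i -> S i) -> U S.
  by move=> UP UQ PQS; apply: (filterS _ (filterI UP UQ)) => i [/PQS]; apply.
have [m0] := carrier_inhabited M.
have inhX : inhabited (I -> M) by exists; exact: (fun=> m0).
have Lpre : preorder L.
  split=> [x|x y z xy yz]; first by apply: UT => i; apply: Mr.
  by apply: (US2 _ _ _ xy yz) => i; apply: Mt.
have [|B [pi [pi_surj pi_le pi_op Bpo]]] :=
    @preorder_quotient _ _ L (fun g x i => @sop F M g (x i)) inhX Lpre.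
  move=> g x y xy yx; apply: (US2 _ _ _ xy yx) => i /= xyi yxi.
  by rewrite (Ma (x i) (y i)).
exists B, pi; split=> //; have [Br Ba Bt] := Bpo.
have eval_pi t (v : nat -> I -> M) :
    eval (fun n => pi (v n)) t = pi (fun i => eval (fun n => v n i) t).
  by elim: t => //= g t ->; rewrite -pi_op.
(* Los's theorem, by induction on the formula. *)
have los p : forall v : nat -> I -> M,
    sat (fun n => pi (v n)) p <-> U [set i | sat (fun n => v n i) p].
  elim: p => [|t u|t u|p IHp q IHq|n p IHp] v /=.
  - split=> // U0; apply: (filter_not_empty U).
    by apply: filterS U0 => i.
  - rewrite !eval_pi; split=> [E|UE].
      have [/pi_le tu /pi_le ut] : sle (pi (fun i => eval (v^~ i) t)) (pi (fun i => eval (v^~ i) u)) /\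
          sle (pi (fun i => eval (v^~ i) u)) (pi (fun i => eval (v^~ i) t)).
        by rewrite E; split; apply: Br.
      by apply: (US2 _ _ _ tu ut) => i; apply: Ma.
    by apply: Ba; apply/pi_le; apply: filterS UE => i /= ->; apply: Mr.
  - by rewrite !eval_pi pi_le.
  - rewrite IHp IHq; split=> [pq|Upq Up]; last by apply: (US2 _ _ _ Upq Up) => i; apply.
    have [/pq|] := in_ultra_setVsetC [set i | sat (v^~ i) p] UU.
      by apply: filterS => i qi _.
    by apply: filterS => i np /np.
  - have upd (x : I -> M) : update (fun k => pi (v k)) n (pi x) = (fun k => pi (update v n x k)).
      by apply/funext => k; rewrite /update; case: eqP.
    have updi (x : I -> M) i : (fun k => update v n x k i) = update (v^~ i) n (x i).
      by apply/funext => k; rewrite /update; case: eqP.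
    split=> [H|UH b]; last first.
      have [x <-] := pi_surj b; rewrite upd; apply/IHp.
      by apply: filterS UH => i /(_ (x i)); rewrite -updi.
    (* In each coordinate a counterexample is chosen if there is one; truth at the resulting point
       then gives the universal statement in almost all coordinates. *)
    have wit i : exists a, sat (update (v^~ i) n a) p -> forall a', sat (update (v^~ i) n a') p.
      have [all_|] := EM (forall a', sat (update (v^~ i) n a') p); first by exists m0.
      by move=> /existsNP[a na]; exists a.
    have [x xP] := choice wit.
    by move: (H (pi x)); rewrite upd => /IHp; apply: filterS => i /=; rewrite updi; apply: xP.
move=> p [_ /(_ M erefl) Mp] v.
have [x xP] := choice (fun n => pi_surj (v n)).
by have -> : v = (fun n => pi (x n)); [apply/funext|apply/los/UT => i; apply: Mp].
Qed.

Lemma embed_in_model (F : Type) (M A : structure F) : partial_order M -> partial_order A ->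
  (forall s : seq A, exists h : A -> M, forall x y, List.In x s -> List.In y s ->
     (sle (h x) (h y) <-> sle x y) /\ forall g, sop g x = y -> h y = sop g (h x)) ->
  exists B, models (Th M) B /\ exists h : A -> B, embedding h.
Proof.
move=> Mpo Apo /choice[h hP]; have [Mr _ _] := Mpo.
(* For an ultrafilter above [F0], almost every list contains any finitely many given elements of
   [A]; the local maps [h i] therefore combine into an embedding. *)
pose F0 : set_system (seq A) := [set P | exists s, forall i,
  (forall x, List.In x s -> List.In x i) -> P i].
have F0P : ProperFilter F0.
  split; first by move=> [s /(_ s)]; apply.
  split=> [|P Q [s sP] [t tQ]|P Q PQ [s sP]]; first by exists [::].
  - exists (s ++ t) => i st; split; [apply: sP|apply: tQ] => x xs; apply: st.
      by apply/List.in_app_iff; left.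
    by apply/List.in_app_iff; right.
  - by exists s => i /sP/PQ.
have [U [UU F0U]] := ultraFilterLemma F0P.
have [B [pi [TB Bpo pi_le pi_op]]] := ultrapower Mpo UU.
have Us (s : seq A) (P : set (seq A)) :
    (forall i, (forall x, List.In x s -> List.In x i) -> P i) -> U P.
  by move=> sP; apply: F0U; exists s.
exists B; split=> //; exists (fun a => pi (fun i => h i a)).
apply: embedding_poset => // [x y|g x].
  rewrite pi_le; split=> [Uxy|xy].
    have Uin : U [set i | List.In x i /\ List.In y i].
      by apply: (Us [:: x; y]) => i xyi; split; apply: xyi => /=; tauto.
    have [i [/= hxy [xi yi]]] := filter_ex (filterI Uxy Uin).
    by have [/(_ hxy)] := (hP i x y xi yi).1.
  apply: (Us [:: x; y]) => i xyi; apply/(hP i x y _ _).1 => //; apply: xyi => /=; tauto.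
have [_ Ba _] := Bpo; rewrite -pi_op.
have hop i : (forall z, List.In z [:: x; sop g x] -> List.In z i) ->
    h i (sop g x) = sop g (h i x).
  by move=> xi; apply: (hP i x (sop g x) _ _).2 => //; apply: xi => /=; tauto.
by apply: Ba; apply/pi_le; apply: (Us [:: x; sop g x]) => i /hop /= ->; apply: Mr.
Qed.

(** Orbits have at most [m.+2] elements, so a finite list generates a finite member of [K]. Outside
    the generated part [h] takes the arbitrary value [m0]. *)
Lemma locally_embeds (K : set (structure unit)) (M A : structure unit) m :
  hereditary K -> (forall B, finite_members K B -> age M B) ->
  iterate_condition m A -> K A ->
  forall s : seq A, exists h : A -> M, forall x y, List.In x s -> List.In y s ->
     (sle (h x) (h y) <-> sle x y) /\ forall g, sop g x = y -> h y = sop g (h x).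
Proof.
move=> Kher Kage Am KA s.
have [m0] := carrier_inhabited M.
(* The empty list is set apart because a substructure must be nonempty. *)
have [-> |[y0 y0s]] : s = [::] \/ exists y, List.In y s.
  by case: s => [|y s]; [left|right; exists y; left].
  by exists (fun=> m0).
pose S := [set x : A | exists y k, List.In y s /\ x = iter k (sop tt) y].
have S_closed : op_closed S.
  by move=> [] x [y [k [ys ->]]]; exists y, k.+1.
have sS y : List.In y s -> S y by move=> ys; exists y, 0.
pose SS := Subuniverse S_closed (ex_intro _ y0 (sS _ y0s)).
have [_ [e [_ e_le e_op]]] : age M (substructure SS).
  apply: Kage; split.
    apply: (Kher _ _ (fun x : substructure SS => sval x : A)) KA; split=> // x y.
    by apply: eq_sig_hprop => z p q; apply: Prop_irrelevance.
  have -> : [set: substructure SS] = (fun x : substructure SS => sval x : A) @^-1` S.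
    by apply/seteqP; split=> // x _; apply: svalP x.
  apply: finite_preimage.
    by move=> x y _ _; apply: eq_sig_hprop => z p q; apply: Prop_irrelevance.
  apply/finite_setE_In.
  exists (List.map (fun x => iter x.1 (sop tt) x.2) (List.list_prod (iota 0 m.+2) s)).
  move=> _ [y [k [ys ->]]]; have [k' [kk' kE]] := iter_reduce m k.
  rewrite (kE A Am); apply/List.in_map_iff; exists (k', y); split=> //.
  by apply: List.in_prod => //; apply/InP; rewrite mem_iota.
have exh x : exists z : M, forall Sx : S x, z = e (exist _ x Sx).
  have [Sx|nSx] := pselect (S x); last by exists m0 => Sx; case: (nSx Sx).
  by exists (e (exist _ x Sx)) => Sx'; congr (e (exist _ _ _)); apply: Prop_irrelevance.
have [h hE] := choice exh; exists h => x y /sS Sx /sS Sy.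
rewrite (hE x Sx) (hE y Sy) e_le; split=> // g gxy; rewrite -e_op; congr e.
by apply: eq_sig_hprop => [z p q|/=]; [apply: Prop_irrelevance|].
Qed.

Lemma linear_fraisse (K0 : set (structure unit)) (H : set (set (structure unit))) :
  hereditary K0 -> locally_determined K0 ->
  (forall A, K0 A -> partial_order A) -> amalgamation (satisfying K0 H) ->
  (forall K A, (forall B, K B -> K0 B) -> models (theory_of K) A -> K0 A) ->
  (forall c, H c -> expressible_one_universal c) ->
  let K := satisfying K0 H in
  (exists A, finite_members K A) ->
  exists M : structure unit,
    [/\ fraisse_limit (finite_members K) M, K M
      & (exists m : nat, H (iterate_condition m)) ->
        [/\ omega_categorical (Th M), quantifier_elimination (Th M)
          & model_completion (Th M) (theory_of K)]].
Proof.
move=> K0her K0loc K0po Kam K0th H1 K Kne.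
have Kher : hereditary K by apply: satisfying_hereditary.
(* [K] is an elementary class: its defining conditions, those in [H] included, belong to its
   theory. *)
have Kth A : models (theory_of K) A -> K A.
  move=> TA; split; first by apply: (K0th K) => // B [].
  move=> c Hc; have [p [_ cp]] := H1 c Hc; apply/cp.
  by apply: (theory_of_holds TA) => B [_ HB]; apply/cp; exact: HB.
have [|A [/K0po]//|M [Mlim KM Mhom]] := fraisse Kher _ _ Kam Kne.
  exact: satisfying_locally_determined.
exists M; split=> // -[m Hm]; have [Mcnt _ Mage] := Mlim.
have Mm : iterate_condition m M by case: KM => _; apply.
have Mpo : partial_order M by apply: K0po; case: KM.
have Mqe := homogeneous_qe Mm Mhom.
split=> //; first exact: (homogeneous_omega_categorical Mpo Mm Mhom Mcnt).
split=> [A TA p [ps Kp]|A /Kth KA|A _ B C h k TB TC eh ek p v].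
- by apply: TA; split=> // _ ->; apply: Kp.
- apply: embed_in_model => //; first by apply: K0po; case: KA.
  apply: (@locally_embeds K M A m) => // [B KB|]; first exact/Mage.
  by case: KA => _; apply.
(* The truth of the quantifier-free equivalent is already decided in [A], hence it is the same in
   both extensions. *)
- have [q [qf _ qP]] := Mqe p.
  by rewrite (qP B TB) (qP C TC) -(sat_embedding _ eh qf) -(sat_embedding _ ek qf).
Qed.

Theorem theorem5p2 :
  (forall (K0 : set (structure unit)) (H : set (set (structure unit))),
     K0 = LO_p \/ K0 = LO_r ->
     (forall c, H c -> expressible_one_universal c) ->
     let K := satisfying K0 H in
     (exists A, finite_members K A) ->
     exists M : structure unit,
       [/\ fraisse_limit (finite_members K) M,
           K M
         & (exists m : nat, H (iterate_condition m)) ->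
           [/\ omega_categorical (Th M),
               quantifier_elimination (Th M)
             & model_completion (Th M) (theory_of K)]])
  /\
  (forall (F : finType) (F1 F2 F3 F4 : {set F})
          (H : set (set (structure F))),
     (forall g : F, [|| g \in F1, g \in F2, g \in F3 | g \in F4]) ->
     (forall c, H c -> expressible_one_universal c) ->
     let K := satisfying (PO F1 F2 F3 F4) H in
     (exists A, finite_members K A) ->
     exists M : structure F,
       fraisse_limit (finite_members K) M /\ K M).
Proof.
split=> [K0 H [->|->] H1 K|F F1 F2 F3 F4 H _ H1 K Kne].
- apply: linear_fraisse => //.
  + exact: LO_p_hereditary.
  + exact: LO_p_locally_determined.
  + by move=> A [[]].
  + exact: LO_p_amalgamation.
  + move=> K' A K'lo TA; split; first by apply: (theory_of_linear_order _ TA) => B /K'lo[].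
    by apply: (theory_of_order_preserving _ TA) => B /K'lo[].
- apply: linear_fraisse => //.
  + exact: LO_r_hereditary.
  + exact: LO_r_locally_determined.
  + by move=> A [[]].
  + exact: LO_r_amalgamation.
  + move=> K' A K'lo TA; split; first by apply: (theory_of_linear_order _ TA) => B /K'lo[].
    by apply: (theory_of_order_reversing _ TA) => B /K'lo[].
have [||||M [Mlim KM _]] := @fraisse F K _ _ _ _ Kne; last by exists M.
- exact: satisfying_hereditary H1 (@PO_hereditary _ _ _ _ _).
- exact: satisfying_locally_determined H1 (@PO_locally_determined _ _ _ _ _).
- by move=> A [[]].
- exact: PO_amalgamation.
Qed.
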